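(* For every nontrivial knot type $[K]$, $1+\sqrt{1+c[K]}\le \mathrm{sps}[K]$, where $c[K]$ is the crossing number of $[K]$.
   Context: The crossing number $c[K]$ is the minimum number of crossings in a diagram of $[K]$. A spherical stick diagram of $[K]$ is a closed curve on the 2-sphere formed by finitely many arcs of great circles (not entire great circles) joined end to end, whose self-intersections are transverse double points away from the arc endpoints, with crossing information at each self-intersection, representing $[K]$. For nontrivial $[K]$, $\mathrm{sps}[K]$ is the minimum number of great circle arcs in such a diagram (undefined for the unknot). *)

(* Defs.v *)
From mathcomp Require Import all_boot all_order all_algebra.
From mathcomp Require Import reals.
From Stdlib Require Import Relation_Operators.
Set Implicit Arguments. Unset Strict Implicit. Unset Printing Implicit Defensive.
Import Order.TTheory GRing.Theory Num.Theory.
Local Open Scope ring_scope.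

Section Knots.
Variable R : realType.

Definition pt := 'rV[R]_3.

Definition seg (a b : pt) (x : pt) : Prop :=
  exists2 t : R, (0 <= t <= 1) & x = (1 - t) *: a + t *: b.

Definition tri (a b c : pt) (x : pt) : Prop :=
  exists t1 t2 t3 : R, [/\ 0 <= t1, 0 <= t2, 0 <= t3, t1 + t2 + t3 = 1
                         & x = t1 *: a + t2 *: b + t3 *: c].

Definition vtx (p : seq pt) (i : nat) : pt := nth 0 p (i %% size p).
Definition edge (p : seq pt) (i : nat) (x : pt) : Prop :=
  seg (vtx p i) (vtx p i.+1) x.
Definition poly_img (p : seq pt) (x : pt) : Prop :=
  exists2 i, (i < size p)%N & edge p i x.

Definition adjacent (p : seq pt) (i j : nat) : Prop :=
  j = (i.+1 %% size p)%N \/ i = (j.+1 %% size p)%N.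

Definition simple_polygon (p : seq pt) : Prop :=
  [/\ (3 <= size p)%N,
      (forall i, (i < size p)%N -> vtx p i != vtx p i.+1),
      (forall i j, (i < size p)%N -> (j < size p)%N -> j = (i.+1 %% size p)%N ->
          forall x, edge p i x -> edge p j x -> x = vtx p j)
    & (forall i j, (i < size p)%N -> (j < size p)%N -> i != j -> ~ adjacent p i j ->
          forall x, edge p i x -> ~ edge p j x)].

Definition collinear (a b c : pt) : Prop := exists t : R, c - a = t *: (b - a).

Definition delta_move (p q : seq pt) : Prop :=
  exists a b c l, [/\ p = a :: b :: l, q = a :: c :: b :: l, ~ collinear a b c
     & forall x, tri a b c x -> poly_img p x -> seg a b x].

Definition knot_step (p q : seq pt) : Prop :=
  [/\ simple_polygon p, simple_polygon q
    & delta_move p q \/ q = rot 1 p \/ q = rev p].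

(* combinatorial (= ambient isotopy) equivalence of polygonal knots;
   knots are unoriented *)
Definition knot_equiv : seq pt -> seq pt -> Prop := clos_refl_sym_trans _ knot_step.

Definition unknotted (k : seq pt) : Prop :=
  exists a b c, knot_equiv k [:: a; b; c].

Definition nontrivial_knot (k : seq pt) : Prop := simple_polygon k /\ ~ unknotted k.

Definition piece (f : pt -> pt) (p : seq pt) (i : nat) (y : pt) : Prop :=
  exists2 x, edge p i x & y = f x.

(* the projected curve is a regular diagram: nondegenerate pieces, adjacent
   pieces meet only at their common vertex, non-adjacent pieces meet in at
   most one point, which is not the image of a vertex (so it is a transverse
   crossing away from the endpoints), and there are no triple points *)
Definition regular_proj (f : pt -> pt) (p : seq pt) : Prop :=
  [/\ (forall i, (i < size p)%N -> f (vtx p i) != f (vtx p i.+1)),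
      (forall i j, (i < size p)%N -> (j < size p)%N -> j = (i.+1 %% size p)%N ->
          forall y, piece f p i y -> piece f p j y -> y = f (vtx p j)),
      (forall i j, (i < size p)%N -> (j < size p)%N -> i != j -> ~ adjacent p i j ->
          forall y y', piece f p i y -> piece f p j y ->
                       piece f p i y' -> piece f p j y' -> y = y'),
      (forall i j, (i < size p)%N -> (j < size p)%N -> i != j -> ~ adjacent p i j ->
          forall y, piece f p i y -> piece f p j y ->
          forall l, (l < size p)%N -> y != f (vtx p l))
    & (forall i j l, (i < size p)%N -> (j < size p)%N -> (l < size p)%N ->
          i != j -> j != l -> i != l ->
          ~ (exists y, [/\ piece f p i y, piece f p j y & piece f p l y]))].

Definition num_crossings (f : pt -> pt) (p : seq pt) (c : nat) : Prop :=
  exists s : seq (nat * nat), [/\ uniq s, size s = c &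
    forall i j, (i, j) \in s <->
      [/\ (i < j)%N, (j < size p)%N, ~ adjacent p i j
        & exists y, piece f p i y /\ piece f p j y]].

Definition proj_xy (x : pt) : pt := \row_(i < 3) (if i == ord_max then 0 else x 0 i).

Definition has_diagram (k : seq pt) (c : nat) : Prop :=
  exists k', [/\ knot_equiv k k', regular_proj proj_xy k' & num_crossings proj_xy k' c].

Definition is_crossing_number (k : seq pt) (c : nat) : Prop :=
  has_diagram k c /\ forall c', has_diagram k c' -> (c <= c')%N.

Definition sdir (x : pt) : pt := (Num.sqrt (\sum_(i < 3) x 0 i ^+ 2))^-1 *: x.

Definition coplanar0 (a b c : pt) : Prop :=
  \det (\matrix_(i < 3, j < 3) (nth 0 [:: a; b; c] i) 0 j) = 0.

(* A spherical stick diagram of the knot type of k made of n great circle arcs: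
   a polygonal knot k' equivalent to k, avoiding the origin, whose radial
   projection to S^2 is a regular diagram (each edge projects onto a proper
   great circle arc; crossing information is given by the distance to the
   origin).  The projected curve is the concatenation of n great circle arcs,
   whose endpoints are the projections of the vertices indexed by B; at every
   other vertex the curve continues along the same great circle.  n >= 2
   ensures that no arc is an entire great circle. *)
Definition spherical_stick_diagram (k : seq pt) (n : nat) : Prop :=
  exists k', [/\ knot_equiv k k',
    (forall i, (i < size k')%N -> vtx k' i != 0),
    (forall i, (i < size k')%N -> sdir (vtx k' i) != - sdir (vtx k' i.+1)),
    regular_proj sdir k'
  & exists B : seq nat, [/\ uniq B, all (fun j => j < size k')%N B, size B = n,
        (2 <= n)%N
      & forall j, (j < size k')%N -> j \notin B ->
          coplanar0 (vtx k' (j + size k' - 1)) (vtx k' j) (vtx k' j.+1)]].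

End Knots.

(* Main.v *)
(** Let n arcs carry a spherical diagram.  Two great circles with different
   planes meet in two antipodal points, so every crossing is determined by an
   ordered pair of distinct arcs (the order encodes the sign of the crossing
   point along the cross product of the two normals).  Each of the n junctions
   of consecutive arcs occupies such a pair in the same way, and a crossing
   cannot lie at a junction; hence there are at most n(n-1) - n crossings, and
   c <= n(n-2) once the spherical diagram is turned into a planar one with the
   same crossings.

   For the latter choose a ray -d from the origin missing the diagram, and two
   linear forms u1, u2 vanishing on d.  The shear
   x |-> x + K (|u1 x| + |u2 x|) d is homogeneous, is linear on each edge after
   the edges have been subdivided at u1 = 0 and u2 = 0, and pushes the knot into
   a half-space z > 0 when K is large.  The projective map
   (x, y, z) |-> (x/z, y/z, -1/z) then turns the central projection into the
   vertical one.  Both maps are the ends of isotopies through injective maps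
   that send edges to segments; such isotopies are compositions of triangle
   moves because simplicity of a polygon is an open condition and [0, 1] is
   compact. *)
Require Import Defs.
From mathcomp Require Import all_boot all_order all_algebra reals.
From mathcomp Require Import classical_sets boolp ring lra zify.
From Stdlib Require Import Relation_Operators.
Set Implicit Arguments. Unset Strict Implicit. Unset Printing Implicit Defensive.
Import Order.TTheory GRing.Theory Num.Theory.
Local Open Scope ring_scope.

(** Central projection onto a plane shows only an open half of the sphere, while the diagram may
    meet every hemisphere, so that no rotation makes it planar; this is the obstacle that the shear
    removes. It is injective because both forms are constant along [d], and it maps rays to rays.
    Hence two points of the polygon have the same [sdir] exactly when their images under the two
    maps have the same [proj_xy]. Regularity speaks of a projection only through this relation, so
    the diagram need not be followed through the isotopies; only simplicity is maintained there. The
    price is the folds of the shear: they create vertices on the planes of the two forms, and a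
    vertex must not be a crossing. For this reason the forms depend on a real parameter, and each of
    finitely many conditions excludes only the roots of a nonzero polynomial. In the count, three
    families of ordered pairs of arcs are disjoint: the diagonal, the junctions and the crossings.
    For n = 2 both junctions lie between the same two arcs, and only the orientation tells their
    pairs apart. *)

Section Vectors.
Variable R : realType.
Implicit Types (u v w x y a b c d : pt R) (s t l : R).

Definition cx u := u ord0 (Ordinal (isT : 0 < 3)%N).
Definition cy u := u ord0 (Ordinal (isT : 1 < 3)%N).
Definition cz u := u ord0 (Ordinal (isT : 2 < 3)%N).
Definition mkpt (p q r : R) : pt R := \row_(i < 3) nth 0 [:: p; q; r] i.

Lemma ptP u v : cx u = cx v -> cy u = cy v -> cz u = cz v -> u = v.
Proof.
move=> h0 h1 h2; apply/rowP => -[[|[|[|//]]] Hi].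
- by rewrite (_ : Ordinal Hi = Ordinal (isT : 0 < 3)%N) //; apply: val_inj.
- by rewrite (_ : Ordinal Hi = Ordinal (isT : 1 < 3)%N) //; apply: val_inj.
- by rewrite (_ : Ordinal Hi = Ordinal (isT : 2 < 3)%N) //; apply: val_inj.
Qed.

Lemma cxD u v : cx (u + v) = cx u + cx v. Proof. by rewrite /cx mxE. Qed.
Lemma cyD u v : cy (u + v) = cy u + cy v. Proof. by rewrite /cy mxE. Qed.
Lemma czD u v : cz (u + v) = cz u + cz v. Proof. by rewrite /cz mxE. Qed.
Lemma cxN u : cx (- u) = - cx u. Proof. by rewrite /cx mxE. Qed.
Lemma cyN u : cy (- u) = - cy u. Proof. by rewrite /cy mxE. Qed.
Lemma czN u : cz (- u) = - cz u. Proof. by rewrite /cz mxE. Qed.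
Lemma cxZ s u : cx (s *: u) = s * cx u. Proof. by rewrite /cx mxE. Qed.
Lemma cyZ s u : cy (s *: u) = s * cy u. Proof. by rewrite /cy mxE. Qed.
Lemma czZ s u : cz (s *: u) = s * cz u. Proof. by rewrite /cz mxE. Qed.
Lemma cx0 : cx 0 = 0. Proof. by rewrite /cx mxE. Qed.
Lemma cy0 : cy 0 = 0. Proof. by rewrite /cy mxE. Qed.
Lemma cz0 : cz 0 = 0. Proof. by rewrite /cz mxE. Qed.
Lemma cxE p q r : cx (mkpt p q r) = p. Proof. by rewrite /cx mxE. Qed.
Lemma cyE p q r : cy (mkpt p q r) = q. Proof. by rewrite /cy mxE. Qed.
Lemma czE p q r : cz (mkpt p q r) = r. Proof. by rewrite /cz mxE. Qed.
Definition coE := (cxD, cyD, czD, cxN, cyN, czN, cxZ, cyZ, czZ, cx0, cy0, cz0,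
  cxE, cyE, czE).

Definition dot u v := cx u * cx v + cy u * cy v + cz u * cz v.
Definition cross u v := mkpt (cy u * cz v - cz u * cy v)
  (cz u * cx v - cx u * cz v) (cx u * cy v - cy u * cx v).

Lemma dotDr u v w : dot u (v + w) = dot u v + dot u w.
Proof. rewrite /dot !coE; ring. Qed.
Lemma dotZr u s v : dot u (s *: v) = s * dot u v.
Proof. rewrite /dot !coE; ring. Qed.
Lemma dotZl s u v : dot (s *: u) v = s * dot u v.
Proof. rewrite /dot !coE; ring. Qed.
Lemma dotNr u v : dot u (- v) = - dot u v.
Proof. rewrite /dot !coE; ring. Qed.
Lemma dotC u v : dot u v = dot v u.
Proof. rewrite /dot; ring. Qed.
Lemma dot0r u : dot u 0 = 0.
Proof. rewrite /dot !coE; ring. Qed.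
Lemma dot0l u : dot 0 u = 0.
Proof. by rewrite dotC dot0r. Qed.
Lemma dot_crossl u v : dot (cross u v) u = 0.
Proof. rewrite /dot /cross !coE; ring. Qed.
Lemma dot_crossr u v : dot (cross u v) v = 0.
Proof. rewrite /dot /cross !coE; ring. Qed.
Lemma dot_cross_rot u v w : dot (cross u v) w = dot (cross v w) u.
Proof. rewrite /dot /cross !coE; ring. Qed.
Lemma crossC u v : cross u v = - cross v u.
Proof. apply: ptP; rewrite /cross !coE; ring. Qed.
Lemma crossDr u v w : cross u (v + w) = cross u v + cross u w.
Proof. apply: ptP; rewrite /cross !coE; ring. Qed.
Lemma crossDl u v w : cross (u + v) w = cross u w + cross v w.
Proof. apply: ptP; rewrite /cross !coE; ring. Qed.
Lemma crossZr u s v : cross u (s *: v) = s *: cross u v.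
Proof. apply: ptP; rewrite /cross !coE; ring. Qed.
Lemma crossZl u s v : cross (s *: u) v = s *: cross u v.
Proof. apply: ptP; rewrite /cross !coE; ring. Qed.
Lemma crossvv u : cross u u = 0.
Proof. apply: ptP; rewrite /cross !coE; ring. Qed.
Lemma crossv0 u : cross u 0 = 0.
Proof. apply: ptP; rewrite /cross !coE; ring. Qed.
Lemma cross0v u : cross 0 u = 0.
Proof. apply: ptP; rewrite /cross !coE; ring. Qed.
Lemma crossA u v w : cross u (cross v w) = dot u w *: v - dot u v *: w.
Proof. apply: ptP; rewrite /cross /dot !coE; ring. Qed.

Lemma dotvv_ge0 u : 0 <= dot u u.
Proof. by rewrite /dot !addr_ge0 // -expr2 sqr_ge0. Qed.

Lemma dotvv_eq0 u : dot u u = 0 -> u = 0.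
Proof.
rewrite /dot -!expr2 => /eqP; rewrite !paddr_eq0 ?addr_ge0 ?sqr_ge0 //.
by rewrite !sqrf_eq0 => /andP[/andP[/eqP hx /eqP hy] /eqP hz]; apply: ptP; rewrite coE.
Qed.

Lemma dotvv_gt0 u : u != 0 -> 0 < dot u u.
Proof. by move=> h; rewrite lt0r dotvv_ge0 andbT; apply: contra h => /eqP/dotvv_eq0->. Qed.

Lemma cross_eq0 u v : u != 0 -> cross u v = 0 -> v = (dot u v / dot u u) *: u.
Proof.
move=> u0 h; have uu := dotvv_gt0 u0.
have : dot u u *: v = dot u v *: u.
  have := crossA u u v; rewrite h crossv0 => /eqP; rewrite eq_sym subr_eq0.
  by move=> /eqP ->.
move=> e; rewrite mulrC -scalerA -e scalerA mulVf ?scale1r ?gt_eqF //.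
Qed.

(** Cramer's rule: the identity [e] expands [v] in the frame [a], [b], [cross a b], and the last
    coefficient vanishes by hypothesis. *)
Lemma plane_basis a b v : cross a b != 0 -> dot (cross a b) v = 0 ->
  exists s t, v = s *: a + t *: b.
Proof.
move=> n0 h; set n := cross a b in n0 h *.
have nn := dotvv_gt0 n0.
exists (dot (cross v b) n / dot n n), (dot (cross a v) n / dot n n).
have e : dot n n *: v = dot (cross v b) n *: a + dot (cross a v) n *: b + dot n v *: n.
  by apply: ptP; rewrite /n /dot /cross !coE; ring.
move: e; rewrite h scale0r addr0 => e.
apply: (@scalerI _ _ (dot n n)); first by rewrite gt_eqF.
rewrite e scalerDr !scalerA; congr (_ *: _ + _ *: _); field; by rewrite gt_eqF.
Qed.

(** The cross product serves unless the vectors are dependent; then any normal of a nonzero one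
    does. Such a normal is a cross product with one of the first two basis vectors, since these
    vanish together only for the zero vector. *)
Lemma perp2 u v : exists2 n, n != 0 & dot n u = 0 /\ dot n v = 0.
Proof.
have perp1 w : exists2 n, n != 0 & dot n w = 0.
  have [w0|w0] := eqVneq w 0.
    exists (mkpt 1 0 0); last by rewrite w0 dot0r.
    by apply/eqP => /(congr1 cx); rewrite !coE => /eqP; rewrite oner_eq0.
  have [e|ne] := eqVneq (cross w (mkpt 1 0 0)) 0; last first.
    by exists (cross w (mkpt 1 0 0)) => //; rewrite dot_crossl.
  have [e'|ne] := eqVneq (cross w (mkpt 0 1 0)) 0; last first.
    by exists (cross w (mkpt 0 1 0)) => //; rewrite dot_crossl.
  case/eqP: w0; move: (congr1 cy e) (congr1 cz e) (congr1 cz e').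
  rewrite /cross !coE => h1 h2 h3; apply: ptP; rewrite !coE; lra.
have [e|ne] := eqVneq (cross u v) 0; last first.
  by exists (cross u v); rewrite // dot_crossl dot_crossr.
have [u0|u0] := eqVneq u 0.
  by have [n n0 h] := perp1 v; exists n; rewrite // u0 dot0r.
have [n n0 h] := perp1 u; exists n => //; split=> //.
by rewrite (cross_eq0 u0 e) dotZr h mulr0.
Qed.

(** The sum norm keeps square roots out of the perturbation estimates. *)
Definition nrm u := `|cx u| + `|cy u| + `|cz u|.

Lemma nrm_ge0 u : 0 <= nrm u.
Proof. by rewrite /nrm !addr_ge0. Qed.
Lemma nrmD u v : nrm (u + v) <= nrm u + nrm v.
Proof.
rewrite /nrm !coE; move: (ler_normD (cx u) (cx v)) (ler_normD (cy u) (cy v)).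
by move: (ler_normD (cz u) (cz v)); lra.
Qed.
Lemma nrmZ s u : nrm (s *: u) = `|s| * nrm u.
Proof. by rewrite /nrm !coE !normrM !mulrDr. Qed.
Lemma nrmN u : nrm (- u) = nrm u.
Proof. by rewrite /nrm !coE !normrN. Qed.
Lemma nrm0 : nrm 0 = 0.
Proof. by rewrite /nrm !coE normr0 !addr0. Qed.
Lemma nrm_eq0 u : nrm u = 0 -> u = 0.
Proof.
move=> /eqP; rewrite /nrm !paddr_eq0 ?addr_ge0 // !normr_eq0.
by move=> /andP[/andP[/eqP hx /eqP hy] /eqP hz]; apply: ptP; rewrite coE.
Qed.
Lemma nrm_gt0 u : u != 0 -> 0 < nrm u.
Proof. by move=> h; rewrite lt0r nrm_ge0 andbT; apply: contra h => /eqP/nrm_eq0->. Qed.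

End Vectors.

Arguments cx {R}. Arguments cy {R}. Arguments cz {R}.

(** * Compactness of the unit interval *)

Section Compactness.
Variable R : realType.
Implicit Types (u v w : pt R) (s t : R).

(** Real induction, through the supremum of the points related to 0. It serves twice: with [P] the
    existence of a uniform bound on an interval, and with [P] the equivalence of two stages of an
    isotopy. *)
Lemma interval_induction (P : R -> R -> Prop) :
  (forall a b c, P a b -> P b c -> P a c) ->
  (forall t, 0 <= t <= 1 -> exists2 d, 0 < d & forall a b, 0 <= a -> b <= 1 ->
     t - d < a -> a <= t -> t <= b -> b < t + d -> P a b) ->
  P 0 1.
Proof.
move=> Ptrans Ploc; pose A := [set x : R | 0 <= x <= 1 /\ P 0 x]%classic.
have A0 : A 0.
  split; first by rewrite lexx ler01.
  have [|d d0 h] := Ploc 0; first by rewrite lexx ler01.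
  apply: h; lra.
have Aub : has_ubound A by exists 1 => x [/andP[]].
have As : has_sup A by split=> //; exists 0.
have s0 : 0 <= sup A by apply: ub_le_sup.
have s1 : sup A <= 1 by apply: ge_sup => [|x [/andP[]]]; first by exists 0.
have [|d d0 h] := Ploc (sup A); first by rewrite s0 s1.
have [x [/andP[x0 x1] Px] xs] := sup_adherent d0 As.
have xA : x <= sup A by apply: ub_le_sup => //; split=> //; apply/andP.
(* The relation extends past the supremum unless 1 comes first: the former contradicts the choice of
   the supremum, the latter is the goal. *)
pose b := Num.min 1 (sup A + d / 2).
have bs : sup A <= b by rewrite le_min s1 /=; lra.
have b1 : b <= 1 by rewrite ge_min lexx.
have bd : b < sup A + d by rewrite gt_min; apply/orP; right; lra.
have Pb : P 0 b by apply: Ptrans Px _; apply: h.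
have : b <= sup A.
  by apply: ub_le_sup => //; split=> //; rewrite b1 andbT (le_trans s0).
have [e|lt1] := leP 1 (sup A + d / 2); first by rewrite /b (min_idPl e) in Pb *.
by rewrite /b (min_idPr (ltW lt1)); lra.
Qed.

(** Bounds on two adjacent intervals merge into their minimum, which is why [Q] must be stable under
    lowering the bound. *)
Lemma uniform_bound (Q : R -> R -> Prop) :
  (forall h h' s, h' <= h -> Q h s -> Q h' s) ->
  (forall t, 0 <= t <= 1 -> exists d h, [/\ 0 < d, 0 < h &
     forall s, 0 <= s <= 1 -> `|s - t| < d -> Q h s]) ->
  exists2 h, 0 < h & forall s, 0 <= s <= 1 -> Q h s.
Proof.
move=> Qmon Qloc.
apply: (@interval_induction (fun a b => exists2 h, 0 < h & forall s, a <= s <= b -> Q h s)).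
  move=> a b c [h h0 H] [k k0 K]; exists (Num.min h k); first by rewrite lt_min h0.
  move=> s /andP[sa sc]; have [sb|sb] := leP s b.
    by apply: (Qmon h); [rewrite ge_min lexx | apply: H; rewrite sa].
  by apply: (Qmon k); [rewrite ge_min lexx orbT | apply: K; rewrite ltW].
move=> t /Qloc[d [h [d0 h0 H]]]; exists d => // a b a0 b1 ad at_ tb bd.
exists h => // s /andP[sa sb]; apply: H; first by lra.
by rewrite ltr_norml; lra.
Qed.

Lemma affine_far1 u v : (forall s, 0 <= s <= 1 -> u + s *: v != 0) ->
  exists2 h, 0 < h & forall s, 0 <= s <= 1 -> h <= nrm (u + s *: v).
Proof.
move=> H; apply: uniform_bound => [h h' s hh /(le_trans hh)//|t t01].
have n0 := nrm_gt0 (H _ t01); have v0 := nrm_ge0 v.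
(* Within this radius the norm changes by less than [h / 2]; the added 1 covers the case [v = 0]. *)
set h := nrm _ in n0; exists (h / 2 / (nrm v + 1)), (h / 2); split; [|lra|].
  by rewrite !divr_gt0 //; lra.
move=> s s01; rewrite ltr_pdivlMr; last lra.
move=> hs; have := nrmD (u + s *: v) ((t - s) *: v).
rewrite (_ : _ + _ = u + t *: v); last by apply: ptP; rewrite !coE; ring.
rewrite -/h nrmZ distrC; have := normr_ge0 (s - t); nra.
Qed.

(** Compactness of the square, one parameter at a time: for a fixed first parameter the previous
    lemma bounds the norm uniformly in the second, and half of this bound survives nearby. *)
Lemma affine_far u v w :
  (forall s t, 0 <= s <= 1 -> 0 <= t <= 1 -> u + s *: v + t *: w != 0) ->
  exists2 h, 0 < h & forall s t, 0 <= s <= 1 -> 0 <= t <= 1 -> h <= nrm (u + s *: v + t *: w).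
Proof.
move=> H.
have [|t t01|h h0 K] := @uniform_bound
    (fun h s => forall t, 0 <= t <= 1 -> h <= nrm (u + s *: v + t *: w)); last 1 first.
- by exists h => // s t s01; apply: K.
- by move=> h h' s hh K t /K; apply: le_trans.
have [h h0 K] := affine_far1 (fun s => H t s t01); have v0 := nrm_ge0 v.
exists (h / 2 / (nrm v + 1)), (h / 2); split; [|lra|].
  by rewrite !divr_gt0 //; lra.
move=> s s01; rewrite ltr_pdivlMr; last lra.
move=> hs r r01; have := nrmD (u + s *: v + r *: w) ((t - s) *: v).
rewrite (_ : _ + _ + _ + _ = u + t *: v + r *: w); last by apply: ptP; rewrite !coE; ring.
move: (K r r01); rewrite nrmZ distrC; have := normr_ge0 (s - t); nra.
Qed.

End Compactness.

Arguments vtx : simpl never.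

(** * Polygons as lists of edges *)

Section Edges.
Variable R : realType.
Implicit Types (p q : seq (pt R)) (e f : pt R * pt R) (a b c d x y : pt R).

(** Edges are pairs of end points instead of indices, so that rotations, maps and subdivisions need
    no modular arithmetic. Nothing is lost, since the vertices of a simple polygon are distinct. *)
Definition edges p : seq (pt R * pt R) := zip p (rot 1 p).
Definition on e x := seg e.1 e.2 x.
(** Two edges of a polygon with distinct vertices that share their final points are equal, so
    comparing [e.2] with [f.2] would add nothing. *)
Definition nonadj e f := [&& e.1 != f.1, e.2 != f.1 & f.2 != e.1].

Lemma nonadjC e f : nonadj e f = nonadj f e.
Proof. by rewrite /nonadj eq_sym; congr andb; rewrite andbC. Qed.

Lemma size_edges p : size (edges p) = size p.
Proof. by rewrite /edges size_zip size_rot minnn. Qed.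

Lemma vtx_small p i : (i < size p)%N -> vtx p i = nth 0 p i.
Proof. by move=> h; rewrite /vtx modn_small. Qed.

Lemma vtx_mod p i : vtx p (i %% size p)%N = vtx p i.
Proof. by rewrite /vtx modn_mod. Qed.

Lemma nth_edges p i : (i < size p)%N -> nth (0, 0) (edges p) i = (vtx p i, vtx p i.+1).
Proof.
case: p => [//|x p] hi; rewrite /edges nth_zip ?size_rot // rot1_cons vtx_small //.
rewrite nth_rcons; congr pair; have [h|h] := ltnP i (size p).
  by rewrite vtx_small.
have -> : i = size p by apply/eqP; rewrite eqn_leq h andbT -ltnS.
by rewrite eqxx /vtx modnn.
Qed.

Lemma mem_edges p e : e \in edges p <-> exists2 i, (i < size p)%N & e = (vtx p i, vtx p i.+1).
Proof.
split=> [/(nthP (0, 0))[i] | [i hi ->]].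
  by rewrite size_edges => hi <-; exists i; rewrite ?nth_edges.
by rewrite -nth_edges // mem_nth ?size_edges.
Qed.

Lemma vtx_inj p i j : uniq p -> (i < size p)%N -> (j < size p)%N ->
  vtx p i = vtx p j -> i = j.
Proof.
by move=> up hi hj /eqP; rewrite !vtx_small // nth_uniq // => /eqP.
Qed.

Lemma mem_vtx p i : (0 < size p)%N -> vtx p i \in p.
Proof. by move=> h; rewrite mem_nth // ltn_pmod. Qed.

Lemma memP_vtx p x : x \in p -> exists2 i, (i < size p)%N & x = vtx p i.
Proof. by move=> /(nthP 0)[i hi <-]; exists i; rewrite ?vtx_small. Qed.

Lemma edges_mem1 p e : e \in edges p -> e.1 \in p.
Proof. by move=> /mem_edges[i hi ->]; apply: mem_vtx; apply: leq_trans hi. Qed.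
Lemma edges_mem2 p e : e \in edges p -> e.2 \in p.
Proof. by move=> /mem_edges[i hi ->]; apply: mem_vtx; apply: leq_trans hi. Qed.

Lemma vtxS_inj p i j : uniq p -> (i < size p)%N -> (j < size p)%N ->
  vtx p i.+1 = vtx p j -> j = (i.+1 %% size p)%N.
Proof.
move=> up hi hj; rewrite -vtx_mod => /vtx_inj -> //.
by rewrite ltn_pmod // (leq_trans _ hi).
Qed.

Lemma edges_inj1 p e f : uniq p -> e \in edges p -> f \in edges p -> e.1 = f.1 -> e = f.
Proof.
by move=> up /mem_edges[i hi ->] /mem_edges[j hj ->] /= /vtx_inj ->.
Qed.

Lemma edges_neq p e : (1 < size p)%N -> uniq p -> e \in edges p -> e.1 != e.2.
Proof.
move=> p2 up /mem_edges[i hi ->] /=; apply/eqP => /esym /(vtxS_inj up hi hi) h.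
move: h; have [h|h] := ltnP i.+1 (size p); first by rewrite modn_small //; lia.
have -> : i.+1 = size p by apply/eqP; rewrite eqn_leq hi h.
rewrite modnn => i0; move: h; rewrite i0; lia.
Qed.

Lemma zip_rot (S T : Type) n (s : seq S) (t : seq T) : size s = size t ->
  zip (rot n s) (rot n t) = rot n (zip s t).
Proof.
move=> h; rewrite /rot zip_cat ?size_drop ?h //; congr cat.
  elim: n s t h => [|n IH] [|x s] [|y t] //= [h]; exact: IH.
elim: n s t h => [|n IH] [|x s] [|y t] //= [h]; congr cons; exact: IH.
Qed.

Lemma edges_rot n p : edges (rot n p) = rot n (edges p).
Proof. by rewrite /edges rot_rot zip_rot ?size_rot. Qed.

Lemma mem_edges_rot n p : edges (rot n p) =i edges p.
Proof. by move=> e; rewrite edges_rot mem_rot. Qed.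

Lemma edges_map (g : pt R -> pt R) p :
  edges (map g p) = [seq (g e.1, g e.2) | e <- edges p].
Proof.
rewrite /edges -map_rot.
by elim: p (rot 1 p) => [|x p IH] [|y q] //=; congr cons.
Qed.

Lemma edges_cons a b l : edges (a :: b :: l) = (a, b) :: zip (b :: l) (rcons l a).
Proof. by rewrite /edges rot1_cons. Qed.

Definition simple p := [/\ (2 < size p)%N, uniq p,
  (forall e f, e \in edges p -> f \in edges p -> e.2 = f.1 ->
     forall x, on e x -> on f x -> x = f.1) &
  (forall e f, e \in edges p -> f \in edges p -> nonadj e f ->
     forall x, on e x -> ~ on f x)].

Lemma adjacentP p i j : uniq p -> (i < size p)%N -> (j < size p)%N -> i != j ->
  ~ adjacent p i j <-> nonadj (vtx p i, vtx p i.+1) (vtx p j, vtx p j.+1).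
Proof.
move=> up hi hj ij; rewrite /nonadj /=; split.
  move=> H; apply/and3P; split; apply/eqP.
  - by move=> /(vtx_inj up hi hj)/eqP; apply/negP.
  - by move=> /(vtxS_inj up hi hj) h; apply: H; left.
  - by move=> /(vtxS_inj up hj hi) h; apply: H; right.
move=> /and3P[_ /eqP H1 /eqP H2] [h|h]; [apply: H1|apply: H2];
  by rewrite -vtx_mod -h.
Qed.

Lemma seg_l a b : seg a b a.
Proof. by exists 0; rewrite ?lexx ?ler01 // subr0 scale1r scale0r addr0. Qed.
Lemma seg_r a b : seg a b b.
Proof. by exists 1; rewrite ?lexx ?ler01 // subrr scale1r scale0r add0r. Qed.
Lemma segC a b x : seg a b x -> seg b a x.
Proof. by case=> t t01 ->; exists (1 - t); [lra | rewrite subKr addrC]. Qed.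

(** Distinctness of the vertices is implicit in the index form: equal neighbours would make a
    degenerate edge, and other equal vertices would be a common point of two non-adjacent edges. *)
Lemma simple_polygonP p : simple_polygon p <-> simple p.
Proof.
split=> [[p3 H1 H2 H3]|[p3 up H2 H3]].
  have up : uniq p.
    apply/(uniqP 0) => i j; rewrite !inE => hi hj; rewrite -!vtx_small // => e.
    apply/eqP/contraT => ij.
    have [|na] := pselect (adjacent p i j).
      case=> h; first by have := H1 i hi; rewrite -[vtx p i.+1]vtx_mod -h e eqxx.
      by have := H1 j hj; rewrite -[vtx p j.+1]vtx_mod -h e eqxx.
    have := H3 i j hi hj ij na (vtx p i) (seg_l _ _); rewrite e => -[]; exact: seg_l.
  split=> //.
    move=> e f /mem_edges[i hi ->] /mem_edges[j hj ->] /= /(vtxS_inj up hi hj) ij x.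
    exact: H2.
  move=> e f /mem_edges[i hi ->] /mem_edges[j hj ->] n x; apply: H3 => //.
    by apply: contraTneq n => ->; rewrite /nonadj eqxx.
  by apply/adjacentP => //; apply: contraTneq n => ->; rewrite /nonadj eqxx.
have E i : (i < size p)%N -> (vtx p i, vtx p i.+1) \in edges p.
  by move=> hi; apply/mem_edges; exists i.
split=> //.
- by move=> i hi; apply: (@edges_neq p (vtx p i, vtx p i.+1)) => //; [lia|apply: E].
- move=> i j hi hj ij x; apply: (H2 (vtx p i, vtx p i.+1) (vtx p j, vtx p j.+1)); rewrite ?E //=.
  by rewrite {1}ij vtx_mod.
- move=> i j hi hj ij na x; apply: (H3 (vtx p i, vtx p i.+1) (vtx p j, vtx p j.+1)); rewrite ?E //.
  by apply/adjacentP.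
Qed.

Lemma simple_rot n p : simple p -> simple (rot n p).
Proof.
case=> p3 up H2 H3; split; rewrite ?size_rot ?rot_uniq // => e f;
  rewrite !mem_edges_rot; [exact: H2 | exact: H3].
Qed.

Lemma kequiv_refl p : knot_equiv p p. Proof. exact: rst_refl. Qed.
Lemma kequiv_sym p q : knot_equiv p q -> knot_equiv q p. Proof. exact: rst_sym. Qed.
Lemma kequiv_trans q p r : knot_equiv p q -> knot_equiv q r -> knot_equiv p r.
Proof. exact: rst_trans. Qed.

Lemma kequiv_simple p q : knot_equiv p q -> simple p <-> simple q.
Proof.
elim=> {p q} [p q [/simple_polygonP hp /simple_polygonP hq _]|||] //.
- by move=> p q _ [].
- by move=> p q r _ [h1 h2] _ [h3 h4]; split; auto.
Qed.

Lemma kequiv_rot n p : simple p -> knot_equiv p (rot n p).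
Proof.
move=> sp; elim: n => [|n IH]; first by rewrite rot0; apply: kequiv_refl.
apply: kequiv_trans IH _.
have [h|h] := ltnP n (size p); last first.
  by rewrite !rot_oversize ?(leq_trans h) //; apply: kequiv_refl.
apply: rst_step; split; try by apply/simple_polygonP/simple_rot.
by right; left; rewrite rotS.
Qed.

Lemma kequiv_delta a b c l : simple (a :: b :: l) -> simple (a :: c :: b :: l) ->
  ~ collinear a b c ->
  (forall e, e \in edges (a :: b :: l) -> forall x, tri a b c x -> on e x -> seg a b x) ->
  knot_equiv (a :: b :: l) (a :: c :: b :: l).
Proof.
move=> s1 s2 nc H; apply: rst_step; split; try exact/simple_polygonP.
left; exists a, b, c, l; split=> // x tx [i hi ei].
by apply: (H (vtx (a :: b :: l) i, vtx (a :: b :: l) i.+1)) => //; apply/mem_edges; exists i.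
Qed.

End Edges.

(** * Simplicity is an open condition *)

Section Stability.
Variable R : realType.
Implicit Types (p q : seq (pt R)) (e f : pt R * pt R) (a b c d x y : pt R).

Lemma all_small (T : eqType) (Z : seq T) (Q : R -> T -> Prop) :
  (forall h h' z, h' <= h -> Q h z -> Q h' z) ->
  (forall z, z \in Z -> exists2 h, 0 < h & Q h z) ->
  exists2 h, 0 < h & forall z, z \in Z -> Q h z.
Proof.
move=> Qm; elim: Z => [|z Z IH] H; first by exists 1.
have [|h h0 Hh] := IH; first by move=> y yZ; apply: H; rewrite inE yZ orbT.
have [|k k0 Hk] := H z; first by rewrite mem_head.
exists (Num.min h k); first by rewrite lt_min h0.
move=> y; rewrite inE => /orP[/eqP->|/Hh].
  by apply: Qm Hk; rewrite ge_min lexx orbT.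
by apply: Qm; rewrite ge_min lexx.
Qed.

Lemma nrmZ01 (v : R) x : 0 <= v <= 1 -> nrm (v *: x) = v * nrm x.
Proof. by move=> /andP[v0 _]; rewrite nrmZ ger0_norm. Qed.

Lemma convex_lt (s h m n : R) : 0 <= s <= 1 -> m < h -> n < h -> (1 - s) * m + s * n < h.
Proof.
move=> /andP[s0 s1] mh nh; have [->|sn] := eqVneq s 0; first lra.
have : s * (h - n) > 0 by rewrite mulr_gt0 ?subr_gt0 // lt0r sn.
have : (1 - s) * (h - m) >= 0 by rewrite mulr_ge0 ?subr_ge0 // ltW.
lra.
Qed.

(** The difference of a point of either segment is affine in two parameters and avoids 0, so it
    stays at a distance [h] from 0. Moving all end points by less than [h / 2] changes it by less
    than [h]. *)
Lemma stable_apart a b c d :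
  (forall x, seg a b x -> ~ seg c d x) ->
  exists2 h, 0 < h & forall a' b' c' d',
    nrm (a' - a) < h -> nrm (b' - b) < h -> nrm (c' - c) < h -> nrm (d' - d) < h ->
    forall x, seg a' b' x -> ~ seg c' d' x.
Proof.
move=> H; have [s t s01 t01|h h0 K] := @affine_far R (a - c) (b - a) (c - d).
  apply/eqP => e; apply: (H ((1 - s) *: a + s *: b)); first by exists s.
  exists t => //; apply/eqP; rewrite -subr_eq0 -e; apply/eqP.
  by apply: ptP; rewrite !coE; ring.
exists (h / 2); first by lra.
move=> a' b' c' d' ha hb hc hd x [s s01 ->] [t t01 e].
have := K s t s01 t01.
rewrite (_ : _ + _ + _ = (1 - s) *: (a - a') + s *: (b - b')
            + (1 - t) *: (c' - c) + t *: (d' - d)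
            + ((1 - s) *: a' + s *: b' - ((1 - t) *: c' + t *: d'))); last first.
  by apply: ptP; rewrite !coE; ring.
rewrite e subrr addr0.
have : nrm ((1 - s) *: (a - a') + s *: (b - b') + (1 - t) *: (c' - c) + t *: (d' - d))
    <= (1 - s) * nrm (a' - a) + s * nrm (b' - b) + (1 - t) * nrm (c' - c) + t * nrm (d' - d).
  have s01' : 0 <= 1 - s <= 1 by lra.
  have t01' : 0 <= 1 - t <= 1 by lra.
  have := nrmZ01 (a - a') s01'; have := nrmZ01 (b - b') s01; have := nrmZ01 (c' - c) t01'; have := nrmZ01 (d' - d) t01.
  rewrite -(nrmN (a - a')) opprB -(nrmN (b - b')) opprB.
  have := nrmD ((1 - s) *: (a - a') + s *: (b - b') + (1 - t) *: (c' - c)) (t *: (d' - d)).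
  have := nrmD ((1 - s) *: (a - a') + s *: (b - b')) ((1 - t) *: (c' - c)).
  have := nrmD ((1 - s) *: (a - a')) (s *: (b - b')); lra.
have := convex_lt s01 ha hb; have := convex_lt t01 hc hd; lra.
Qed.

(** The segments touch at [b], so there is no distance to preserve. Instead, a second common point
    would give [r *: (a - b) = (1 - r) *: (c - b)] with [r] in [0, 1], after normalising the two
    weights; this difference is a one-parameter family that avoids 0, and avoiding 0 is stable. *)
Lemma stable_corner a b c : a != b -> b != c ->
  (forall x, seg a b x -> seg b c x -> x = b) ->
  exists2 h, 0 < h & forall a' b' c',
    nrm (a' - a) < h -> nrm (b' - b) < h -> nrm (c' - c) < h ->
    forall x, seg a' b' x -> seg b' c' x -> x = b'.
Proof.
move=> ab bc H; have [s s01|h h0 K] := @affine_far1 R (b - c) ((a - b) + (c - b)).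
  apply/eqP => e.
  have e' : s *: (a - b) = (1 - s) *: (c - b).
    by apply/eqP; rewrite -subr_eq0 -e; apply/eqP/ptP; rewrite !coE; ring.
  have : b + s *: (a - b) = b.
    apply: H; first by exists (1 - s); [lra|apply: ptP; rewrite !coE; ring].
    by rewrite e'; exists (1 - s); [lra|apply: ptP; rewrite !coE; ring].
  move/eqP; rewrite addrC -subr_eq0 addrK scaler_eq0 subr_eq0 (negPf ab) orbF => /eqP s0.
  move: e; rewrite s0 scale0r addr0 => /eqP; rewrite subr_eq0; exact/negP.
exists (h / 2); first by lra.
move=> a' b' c' ha hb hc x [s s01 ->] [t t01 e].
have [st|st] := eqVneq (1 - s + t) 0.
  have [-> _] : s = 1 /\ t = 0 by lra.
  by rewrite subrr scale0r scale1r add0r.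
exfalso; set r := (1 - s) / (1 - s + t).
have st0 : 0 < 1 - s + t by rewrite lt0r st; lra.
have r01 : 0 <= r <= 1.
  by rewrite /r divr_ge0 ?ler_pdivrMr //; lra.
have e' : r *: (a' - b') - (1 - r) *: (c' - b') = 0.
  apply: (@scalerI _ _ (1 - s + t)); first by rewrite gt_eqF.
  rewrite scaler0 scalerBr !scalerA.
  rewrite (_ : _ * r = 1 - s); last by rewrite /r; field.
  rewrite (_ : _ * (1 - r) = t); last by rewrite /r; field.
  apply/eqP; rewrite -(subrr ((1 - t) *: b' + t *: c')) -{1}e -subr_eq0; apply/eqP.
  by apply: ptP; rewrite !coE; ring.
have := K r r01.
rewrite (_ : _ + _ = r *: (a - a') + r *: (b' - b) + (1 - r) *: (b - b') + (1 - r) *: (c' - c)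
   + (r *: (a' - b') - (1 - r) *: (c' - b'))); last first.
  by apply: ptP; rewrite !coE; ring.
rewrite e' addr0.
have : nrm (r *: (a - a') + r *: (b' - b) + (1 - r) *: (b - b') + (1 - r) *: (c' - c))
    <= r * nrm (a' - a) + r * nrm (b' - b) + (1 - r) * nrm (b' - b) + (1 - r) * nrm (c' - c).
  have r01' : 0 <= 1 - r <= 1 by lra.
  have := nrmZ01 (a - a') r01; have := nrmZ01 (b' - b) r01; have := nrmZ01 (b - b') r01'; have := nrmZ01 (c' - c) r01'.
  rewrite -(nrmN (a - a')) opprB -(nrmN (b - b')) opprB.
  have := nrmD (r *: (a - a') + r *: (b' - b) + (1 - r) *: (b - b')) ((1 - r) *: (c' - c)).
  have := nrmD (r *: (a - a') + r *: (b' - b)) ((1 - r) *: (b - b')).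
  have := nrmD (r *: (a - a')) (r *: (b' - b)); lra.
have := convex_lt r01 hb ha; have := convex_lt r01 hc hb; lra.
Qed.

Lemma simple_stable p : simple p -> exists2 h, 0 < h &
  forall g : pt R -> pt R, (forall v, v \in p -> nrm (g v - v) < h) -> simple (map g p).
Proof.
move=> [p3 up H2 H3].
have p2 : (1 < size p)%N by apply: ltnW.
pose close h (g : pt R -> pt R) e := nrm (g e.1 - e.1) < h /\ nrm (g e.2 - e.2) < h.
(* The first clause makes [g] injective on the vertices, so that adjacency in the image polygon is
   adjacency in [p]. *)
pose good (g : pt R -> pt R) e f :=
  [/\ e.1 != f.1 -> g e.1 != g f.1,
      e.2 = f.1 -> forall x, seg (g e.1) (g e.2) x -> seg (g f.1) (g f.2) x -> x = g f.1
    & nonadj e f -> forall x, seg (g e.1) (g e.2) x -> ~ seg (g f.1) (g f.2) x].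
have closeW h h' g e : h' <= h -> close h' g e -> close h g e.
  by move=> hh [h1 h2]; split; [apply: lt_le_trans h1 hh|apply: lt_le_trans h2 hh].
have [||h h0 H] := @all_small _ (edges p) (fun h e => forall f, f \in edges p ->
    forall g, close h g e -> close h g f -> good g e f).
- move=> h h' e hh H f fp g ce cf; apply: H => //; exact: closeW hh _.
- move=> e ep.
  have [||h h0 H] := @all_small _ (edges p) (fun h f =>
    forall g, close h g e -> close h g f -> good g e f).
  + move=> h h' f hh H g ce cf; apply: H => //; exact: closeW hh _.
  + move=> f fp.
    have [h1 h10 K1] : exists2 h, 0 < h &
        forall g, close h g e -> close h g f -> e.1 != f.1 -> g e.1 != g f.1.
      have [E|ne] := eqVneq e.1 f.1; first by exists 1.
      exists (nrm (e.1 - f.1) / 2) => [|g [c1 _] [c2 _] _].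
        by rewrite divr_gt0 // nrm_gt0 // subr_eq0.
      apply/eqP => E; have := nrmD (g f.1 - f.1) (- (g e.1 - e.1)).
      rewrite nrmN E opprB [X in nrm X <= _](_ : _ = e.1 - f.1); last first.
        by apply: ptP; rewrite !coE; ring.
      rewrite -{2}E; lra.
    have [h2 h20 K2] : exists2 h, 0 < h &
        forall g, close h g e -> close h g f ->
        e.2 = f.1 -> forall x, seg (g e.1) (g e.2) x -> seg (g f.1) (g f.2) x -> x = g f.1.
      have [E|ne] := eqVneq e.2 f.1; last by exists 1 => // g _ _ /eqP; rewrite (negPf ne).
      have [||x xe xf|h h0 K] := @stable_corner e.1 f.1 f.2.
      - by rewrite -E; apply: (edges_neq p2).
      - by apply: (edges_neq p2).
      - by apply: (H2 e f) => //; rewrite /on E.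
      exists h => // g [c1 c2] [c3 c4] E' x; rewrite E' => x1 x2.
      exact: (K _ _ _ c1 c3 c4 x x1 x2).
    have [h3 h30 K3] : exists2 h, 0 < h &
        forall g, close h g e -> close h g f ->
        nonadj e f -> forall x, seg (g e.1) (g e.2) x -> ~ seg (g f.1) (g f.2) x.
      have [nef|ne] := boolP (nonadj e f); last by exists 1.
      have [x xe xf|h h0 K] := @stable_apart e.1 e.2 f.1 f.2; first exact: (H3 e f ep fp nef x).
      by exists h => // g [c1 c2] [c3 c4] _; apply: K.
    exists (Num.min h1 (Num.min h2 h3)); first by rewrite !lt_min h10 h20.
    move=> g ce cf; split; [apply: K1|apply: K2|apply: K3];
      by [apply: closeW ce; rewrite !ge_min lexx ?orbT
         |apply: closeW cf; rewrite !ge_min lexx ?orbT].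
  + by exists h => // f fp g ce cf; apply: H.
exists h => // g cg.
have C e : e \in edges p -> close h g e.
  by move=> ep; split; apply: cg; [apply: edges_mem1 | apply: edges_mem2].
have gi x y : x \in p -> y \in p -> g x = g y -> x = y.
  move=> /memP_vtx[i hi ->] /memP_vtx[j hj ->] E.
  have ei : (vtx p i, vtx p i.+1) \in edges p by apply/mem_edges; exists i.
  have ej : (vtx p j, vtx p j.+1) \in edges p by apply/mem_edges; exists j.
  have [K _ _] := H _ ei _ ej g (C _ ei) (C _ ej).
  by apply/eqP; apply: contraT => /K; rewrite E eqxx.
split; rewrite ?size_map //.
- by rewrite map_inj_in_uniq.
- rewrite edges_map => _ _ /mapP[e ep ->] /mapP[f fp ->] /= E x.
  have {}E : e.2 = f.1 by apply: gi => //; [apply: edges_mem2 ep|apply: edges_mem1 fp].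
  have [_ K _] := H _ ep _ fp g (C _ ep) (C _ fp); exact: K.
- rewrite edges_map => _ _ /mapP[e ep ->] /mapP[f fp ->] /= ne x.
  have [_ _ K] := H _ ep _ fp g (C _ ep) (C _ fp); apply: K.
  move: ne; rewrite /nonadj /= => /and3P[n1 n2 n3]; apply/and3P.
  by split; [apply: contra n1|apply: contra n2|apply: contra n3] => /eqP ->.
Qed.

End Stability.

(** * Moving one vertex by triangle moves *)

Section Moves.
Variable R : realType.
Implicit Types (p q : seq (pt R)) (e f : pt R * pt R) (a b c d x y m n : pt R).

(* The edges of the closed polygon x :: rcons s y other than its last edge [y, x]. *)
Definition path_edges x (s : seq (pt R)) y := zip (x :: s) (rcons s y).

Lemma path_edges1 x s y e : e \in path_edges x s y -> e.1 \in x :: s.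
Proof.
rewrite /path_edges => /(nthP (0, 0))[i]; rewrite size_zip size_rcons /= minnn => hi <-.
by rewrite nth_zip ?size_rcons //= mem_nth.
Qed.

Lemma path_edges2 x s y e : e \in path_edges x s y -> e.2 \in y :: s.
Proof.
rewrite /path_edges => /(nthP (0, 0))[i]; rewrite size_zip size_rcons /= minnn => hi <-.
by rewrite nth_zip ?size_rcons //= -mem_rcons mem_nth ?size_rcons.
Qed.

Lemma edges_cons2 a b l : edges (a :: b :: l) = (a, b) :: path_edges b l a.
Proof. exact: edges_cons. Qed.

Lemma path_edges_cons a b l c : path_edges a (b :: l) c = (a, b) :: path_edges b l c.
Proof. by []. Qed.

Lemma path_edges_rcons a l b c : path_edges a (rcons l b) c = rcons (path_edges a l b) (b, c).
Proof. by elim: l a => [|x l IH] a //; rewrite rcons_cons !path_edges_cons IH. Qed.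

Lemma path_edges_subset a b l e : e \in path_edges b l a -> e \in edges (a :: b :: l).
Proof. by rewrite edges_cons2 inE orbC => ->. Qed.

(** Either [e] is the edge that ends at [a], which meets [a, b] only there, or it is not adjacent to
    [a, b] at all. *)
Lemma shared_l a b l e y : simple (a :: b :: l) -> e \in path_edges b l a ->
  e.1 != b -> seg a b y -> on e y -> y = a.
Proof.
move=> [p3 up H2 H3] ep eb y1 y2.
have ab : (a, b) \in edges (a :: b :: l) by rewrite edges_cons2 mem_head.
have [E|ne] := eqVneq e.2 a; first exact: (H2 e (a, b) (path_edges_subset ep) ab E y y2 y1).
case: (H3 _ _ ab (path_edges_subset ep) _ y y1 y2); rewrite /nonadj /= ne eq_sym [b == _]eq_sym eb !andbT.
by apply: contraTneq (path_edges1 ep) => ->; case/andP: up.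
Qed.

Lemma shared_r a b l e y : simple (a :: b :: l) -> e \in path_edges b l a ->
  e.2 != a -> seg a b y -> on e y -> y = b.
Proof.
move=> [p3 up H2 H3] ep ea y1 y2.
have ab : (a, b) \in edges (a :: b :: l) by rewrite edges_cons2 mem_head.
have [E|ne] := eqVneq e.1 b.
  by rewrite -E; apply: (H2 (a, b) e ab (path_edges_subset ep)).
case: (H3 _ _ ab (path_edges_subset ep) _ y y1 y2).
rewrite /nonadj /= ea eq_sym [b == _]eq_sym ne !andbT.
by apply: contraTneq (path_edges1 ep) => ->; case/andP: up.
Qed.

Lemma path_edges_touch1 a b l e : simple (a :: b :: l) -> e \in path_edges b l a -> on e b -> e.1 = b.
Proof.
move=> sp ep eb; apply/eqP/contraT => ne.
have := shared_l sp ep ne (seg_r a b) eb => E.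
by case: sp => _ /=; rewrite E inE eqxx.
Qed.

Lemma path_edges_touch2 a b l e : simple (a :: b :: l) -> e \in path_edges b l a -> on e a -> e.2 = a.
Proof.
move=> sp ep eb; apply/eqP/contraT => ne.
have := shared_r sp ep ne (seg_l a b) eb => E.
by case: sp => _ /=; rewrite E inE eqxx.
Qed.

(** Pairs of old edges are inherited, so only the two new edges need hypotheses. These also keep [x]
    away from the old vertices, because an edge with an end at [x] would meet a new edge there. *)
Lemma simple_insert a b l x : simple (a :: b :: l) -> x != a -> x != b ->
  (forall y, seg a x y -> seg x b y -> y = x) ->
  (forall e y, e \in path_edges b l a -> seg a x y -> on e y -> y = a) ->
  (forall e y, e \in path_edges b l a -> seg x b y -> on e y -> y = b) ->
  simple (a :: x :: b :: l).
Proof.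
move=> sp xa xb C1 C2 C3; have [p3 up H2 H3] := sp.
have xp e : e \in path_edges b l a -> e.1 != x.
  move=> ep; apply: contra_neq xa => E; apply: (C2 e) => //; first exact: seg_r.
  by rewrite /on E; apply: seg_l.
have xp' e : e \in path_edges b l a -> e.2 != x.
  move=> ep; apply: contra_neq xb => E; apply: (C3 e) => //; first exact: seg_l.
  by rewrite /on E; apply: seg_r.
have ab : a != b by move: up; rewrite /= inE negb_or => /andP[/andP[]].
have na e : e \in path_edges b l a -> e.1 != a.
  by move=> ep; apply: contraTneq (path_edges1 ep) => ->; case/andP: up.
have nb e : e \in path_edges b l a -> e.2 != b.
  move=> ep; apply: contraTneq (path_edges2 ep) => ->; rewrite inE eq_sym negb_or ab.
  by case/and3P: up.
have E : edges (a :: x :: b :: l) = (a, x) :: (x, b) :: path_edges b l a by rewrite edges_cons2 path_edges_cons.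
have C2' e y : e \in path_edges b l a -> seg a x y -> on e y -> e.2 = a.
  by move=> ep ys ye; apply: (path_edges_touch2 sp ep); rewrite -(C2 _ _ ep ys ye).
have C3' e y : e \in path_edges b l a -> seg x b y -> on e y -> e.1 = b.
  by move=> ep ys ye; apply: (path_edges_touch1 sp ep); rewrite -(C3 _ _ ep ys ye).
split.
- by rewrite /= ltnS ltnW.
- have : x \notin a :: b :: l.
    rewrite !inE !negb_or xa xb /=; apply/negP => xl.
    have /memP_vtx[i hi Ei] : x \in a :: b :: l by rewrite !inE xl !orbT.
    have : (vtx (a :: b :: l) i, vtx (a :: b :: l) i.+1) \in edges (a :: b :: l).
      by apply/mem_edges; exists i.
    rewrite edges_cons2 inE -Ei => /orP[/eqP[/eqP]|/xp /=]; first by rewrite (negPf xa).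
    by rewrite eqxx.
  move: up; rewrite /= !inE !negb_or => /and3P[/andP[-> ->] -> ->] /and3P[_ -> ->].
  by rewrite eq_sym xa.
- move=> e f; rewrite !E !inE => /or3P[/eqP->|/eqP->|ep] /or3P[/eqP->|/eqP->|fp] /=.
  + by move/eqP; rewrite (negPf xa).
  + by move=> _ y; apply: C1.
  + by move/eqP; rewrite eq_sym (negPf (xp _ fp)).
  + by move/eqP; rewrite eq_sym (negPf ab).
  + by move/eqP; rewrite eq_sym (negPf xb).
  + by move=> <- y ys ye; apply: C3 ye.
  + by move=> _ y ye ys; apply: C2 ye.
  + by move/eqP; rewrite (negPf (xp' _ ep)).
  + exact: H2 (path_edges_subset ep) (path_edges_subset fp).
- move=> e f; rewrite !E !inE => /or3P[/eqP->|/eqP->|ep] /or3P[/eqP->|/eqP->|fp].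
  + by rewrite /nonadj eqxx.
  + by rewrite /nonadj /= eqxx andbF.
  + move=> /and3P[_ _ /eqP n3] y ys ye; apply: n3; exact: C2' fp ys ye.
  + by rewrite /nonadj /= eqxx !andbF.
  + by rewrite /nonadj eqxx.
  + move=> /and3P[_ /eqP n3 _] y ys ye; apply: n3; exact/esym/(C3' _ _ fp ys ye).
  + move=> /and3P[_ /eqP n3 _] y ye ys; apply: n3; exact: C2' ep ys ye.
  + move=> /and3P[_ _ /eqP n3] y ye ys; apply: n3; exact/esym/(C3' _ _ ep ys ye).
  + exact: H3 (path_edges_subset ep) (path_edges_subset fp).
Qed.

(** Displays a point of a swept triangle on an edge of an intermediate polygon through [z], whose
    simplicity then excludes other edges. *)
Lemma tri_fan a b x y : tri a b x y -> exists2 z, seg b x z & seg a z y.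
Proof.
move=> [t1 [t2 [t3 [h1 h2 h3 E ->]]]].
have [t0|t0] := eqVneq (t2 + t3) 0.
  have [-> [-> ->]] : t1 = 1 /\ t2 = 0 /\ t3 = 0 by lra.
  exists b; first exact: seg_l.
  by rewrite scale1r !scale0r !addr0; apply: seg_l.
have t0' : 0 < t2 + t3 by rewrite lt0r t0 addr_ge0.
have [E2 E3] : (t2 + t3) * (1 - t3 / (t2 + t3)) = t2 /\ (t2 + t3) * (t3 / (t2 + t3)) = t3.
  by split; field.
exists ((1 - t3 / (t2 + t3)) *: b + (t3 / (t2 + t3)) *: x).
  exists (t3 / (t2 + t3)) => //.
  by rewrite divr_ge0 ?ler_pdivrMr //; lra.
exists (t2 + t3); first by lra.
by rewrite scalerDr !scalerA E2 E3 (_ : 1 - _ = t1) ?addrA //; lra.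
Qed.

Lemma tri_swap a b x y : tri a b x y -> tri b a x y.
Proof.
move=> [t1 [t2 [t3 [h1 h2 h3 E ->]]]]; exists t2, t1, t3; split=> //; first lra.
by rewrite [t2 *: b + _]addrC.
Qed.

Lemma dot_seg n a b x : seg a b x -> exists2 s, 0 <= s <= 1 &
  forall c, dot n (x - c) = (1 - s) * dot n (a - c) + s * dot n (b - c) /\
  x = (1 - s) *: a + s *: b.
Proof. by case=> s s01 ->; exists s => // c; split=> //; rewrite /dot !coE; ring. Qed.

(* Goes through a :: x :: b :: c :: l.  The normal n keeps the triangles a b x and
   x b c off the edges at b; every other point of these triangles lies on an edge
   at z of one of the simple polygons a :: z :: c :: l. *)
Lemma kequiv_move_generic a b c l x n :
  (forall z, seg b x z -> simple (a :: z :: c :: l)) ->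
  dot n (a - b) = 0 -> dot n (c - b) = 0 -> dot n (x - b) != 0 ->
  knot_equiv (a :: b :: c :: l) (a :: x :: c :: l).
Proof.
move=> S na nc nx.
have sb := S _ (seg_l b x); have sx := S _ (seg_r b x).
have [_ ub Hb _] := sb.
have ab : a != b by move: ub; rewrite /= !inE !negb_or => /andP[/andP[]].
have bc : b != c by move: ub; rewrite /= !inE !negb_or => /and3P[_ /andP[]].
have corner y : seg a b y -> seg b c y -> y = b.
  by apply: (Hb (a, b) (b, c)); rewrite ?edges_cons2 ?path_edges_cons ?inE ?eqxx ?orbT.
have xb : x != b by apply: contraNneq nx => ->; rewrite subrr dot0r.
have xa : x != a by apply: contraNneq nx => ->; rewrite na.
have nbb : dot n (b - b) = 0 by rewrite subrr dot0r.
have nadab y : seg b c y -> dot n (y - b) = 0.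
  by case/(dot_seg n) => s _ /(_ b)[-> _]; rewrite nbb nc !mulr0 addr0.
have ncorner s : 0 <= s <= 1 -> s != 0 -> a - b = s *: (c - b) -> False.
  move=> s01 s0 E; move/eqP: ab; apply; apply: corner; first exact: seg_l.
  exists s => //; apply/eqP; rewrite -subr_eq0; apply/eqP.
  by have := E => /eqP; rewrite -subr_eq0 => /eqP <-; apply: ptP; rewrite !coE; ring.
have ax_bc y : seg a x y -> seg b c y -> False.
  case/(dot_seg n) => s s01 /(_ b)[E Ey] /[dup] ybc /nadab; rewrite E na mulr0 add0r.
  move=> /eqP; rewrite mulf_eq0 (negPf nx) orbF => /eqP s0.
  move: ybc; rewrite Ey s0 scale0r subr0 scale1r addr0 => abc.
  by move/eqP: ab; apply; apply: corner => //; apply: seg_l.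
have ax_xb y : seg a x y -> seg x b y -> y = x.
  case/(dot_seg n) => s s01 /(_ b)[E Ey]; case/(dot_seg n) => t t01 /(_ b)[E' Ey'].
  have st : s = 1 - t by apply: (mulIf nx); move: E; rewrite E' na nbb; lra.
  have : (1 - s) *: (a - b) = 0.
    apply/eqP; rewrite -(subrr y) {1}Ey Ey' st; apply/eqP/ptP; rewrite !coE; ring.
  move/eqP; rewrite scaler_eq0 (subr_eq0 a) (negPf ab) orbF subr_eq0 => /eqP s1.
  by rewrite Ey -s1 subrr scale0r scale1r add0r.
have xb_bc y : seg x b y -> seg b c y -> y = b.
  case/(dot_seg n) => t t01 /(_ b)[E' Ey'] /nadab; rewrite E' nbb mulr0 addr0.
  move=> /eqP; rewrite mulf_eq0 (negPf nx) orbF subr_eq0 => /eqP s1.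
  by rewrite Ey' -s1 subrr scale0r scale1r add0r.
have rest e : e \in path_edges c l a -> e \in path_edges b (c :: l) a.
  by rewrite path_edges_cons inE orbC => ->.
have e1 z e : simple (a :: z :: c :: l) -> e \in path_edges c l a -> e.1 != z.
  move=> [_ uz _ _] ep; apply: contraTneq (path_edges1 ep) => ->.
  by case/and3P: uz.
have shx y z e : seg b x z -> seg a z y -> e \in path_edges c l a -> on e y -> y = a.
  move=> /S sz yz ep ye; apply: (shared_l sz _ _ yz ye); last exact: e1 ep.
  by rewrite path_edges_cons inE ep orbT.
have shr y z e : seg b x z -> seg z c y -> e \in path_edges c l a -> on e y -> y = c.
  move=> /S sz yz ep ye.
  have sz' := simple_rot 1 sz.
  rewrite rot1_cons in sz'; apply: (shared_r sz' _ _ yz ye).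
    by rewrite path_edges_rcons mem_rcons inE ep orbT.
  have [_ uz _ _] := sz; apply: contraTneq (path_edges2 ep) => ->.
  by move: uz; rewrite /= !inE !negb_or eq_sym => /and3P[/and3P[-> _ _] /andP[_ ->] _].
have s4 : simple (a :: x :: b :: c :: l).
  apply: simple_insert => //.
  - move=> e y; rewrite path_edges_cons inE => /orP[/eqP->|ep] ys ye; first by case: (ax_bc y).
    exact: (shx y x e (seg_r _ _)).
  - move=> e y; rewrite path_edges_cons inE => /orP[/eqP->|ep] ys ye; first exact: xb_bc.
    have yz := segC ys; have sy := S _ yz.
    have E := shx _ _ _ yz (seg_r a y) ep ye.
    by have [_ /=] := sy; rewrite E inE eqxx.
apply: (kequiv_trans (q := a :: x :: b :: c :: l)).
  apply: kequiv_delta => //.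
    move=> [t E]; move: nx; rewrite (_ : x - b = (x - a) + (a - b)); last first.
      by apply: ptP; rewrite !coE; ring.
    by rewrite dotDr E dotZr na -(opprB a b) dotNr na oppr0 mulr0 addr0 eqxx.
  move=> e; rewrite edges_cons2 path_edges_cons !inE => /or3P[/eqP->|/eqP->|ep] y ty ye //.
  - have := nadab _ ye; have [t1 [t2 [t3 [h1 h2 h3 E ->]]]] := ty.
    rewrite (_ : _ - b = t1 *: (a - b) + t3 *: (x - b)); last first.
      have Et : t1 = 1 - t2 - t3 by lra.
      by apply: ptP; rewrite Et !coE; ring.
    rewrite dotDr !dotZr na mulr0 add0r => /eqP; rewrite mulf_eq0 (negPf nx) orbF => /eqP t30.
    exists t2; first lra.
    by rewrite t30 scale0r addr0 (_ : 1 - t2 = t1) //; lra.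
  - by have [z z1 z2] := tri_fan ty; rewrite (shx _ _ _ z1 z2 ep ye); apply: seg_l.
(* A triangle move acts at the head of the list; one rotation brings the edge [x, c] there, and [b]
   is removed by a reversed move. *)
have s4' := simple_rot 1 s4; have sx' := simple_rot 1 sx.
apply: kequiv_trans (kequiv_rot 1 s4) _.
apply: kequiv_trans (kequiv_sym (kequiv_rot 1 sx)).
apply: kequiv_sym; rewrite !rot1_cons in s4' sx' *.
apply: kequiv_delta => //.
  move=> [t E].
  have E' : (1 - t) * dot n (x - b) = 0.
    have : dot n (b - x) = dot n (t *: (c - x)) by rewrite E.
    rewrite dotZr -(opprB x b) dotNr (_ : c - x = (c - b) - (x - b)).
      rewrite dotDr dotNr nc; lra.
    by apply: ptP; rewrite !coE; ring.
  move: E' => /eqP; rewrite mulf_eq0 (negPf nx) orbF subr_eq0 => /eqP t1.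
  by move: E; rewrite -t1 scale1r => /addIr E; move/eqP: bc.
move=> e; rewrite -[edges _]/(edges (rcons (x :: c :: l) a)) -rot1_cons mem_edges_rot edges_cons2 path_edges_cons.
rewrite !inE => /or3P[/eqP->|/eqP->|ep] y ty ye //; last first.
  have [z z1 z2] := tri_fan (tri_swap ty).
  rewrite (shr _ _ _ (segC z1) (segC z2) ep ye); exact: seg_r.
have [t1 [t2 [t3 [h1 h2 h3 E Ey]]]] := ty.
have [s s01 /(_ b)[E' Ey']] := dot_seg n ye.
rewrite na mulr0 add0r in E'.
have : dot n (y - b) = t1 * dot n (x - b).
  rewrite (_ : y - b = t1 *: (x - b) + t2 *: (c - b)); last first.
    rewrite Ey.
    have Et : t3 = 1 - t1 - t2 by lra.
    by apply: ptP; rewrite Et !coE; ring.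
  by rewrite [LHS]dotDr !dotZr nc mulr0 addr0.
(* Measured by [n], the point [y] is at fraction [s] of [a, x] and has weight [t1] at [x] in the
   triangle, so the two numbers agree. Comparing the rest puts [a] on [b, c], against the corner at
   [b], unless [y] is [x]. *)
rewrite E' => /(mulIf nx) st1.
have E2 : t2 *: (c - b) = (1 - s) *: (a - b).
  have Et : t3 = 1 - s - t2 by rewrite st1; lra.
  by apply/eqP; rewrite -subr_eq0 -(subrr y) {1}Ey Ey' Et -st1; apply/eqP/ptP; rewrite !coE; ring.
have [s1|s1] := eqVneq s 1.
  by rewrite Ey' s1 subrr scale0r scale1r add0r; apply: seg_l.
have s1' : 0 < 1 - s by rewrite lt0r subr_eq0 eq_sym s1; lra.
have Eab : a - b = (t2 / (1 - s)) *: (c - b).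
  apply: (@scalerI _ _ (1 - s)); first by rewrite gt_eqF.
  by rewrite -E2 scalerA; congr (_ *: _); field; rewrite gt_eqF.
case: (@ncorner (t2 / (1 - s))) => //.
  by rewrite divr_ge0 ?ler_pdivrMr //; lra.
apply: contra_neq ab => E0; apply/eqP; rewrite -subr_eq0 Eab E0 scale0r //.
Qed.

End Moves.

(** * Isotopies as compositions of triangle moves *)

Section Isotopy.
Variable R : realType.
Implicit Types (p q : seq (pt R)) (e f : pt R * pt R) (a b c d x y m n : pt R).

Lemma off_two_planes n1 n2 : n1 != 0 -> n2 != 0 ->
  exists w, dot n1 w != 0 /\ dot n2 w != 0.
Proof.
move=> /dotvv_gt0 h1 /dotvv_gt0 h2.
have [e|ne] := eqVneq (dot n1 n2) 0; last by exists n1; rewrite gt_eqF // dotC.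
by exists (n1 + n2); rewrite !dotDr e [dot n2 n1]dotC e addr0 add0r !gt_eqF.
Qed.

Lemma ball_seg b x y h : nrm (x - b) < h -> nrm (y - b) < h ->
  forall z, seg x y z -> nrm (z - b) < h.
Proof.
move=> hx hy z [s s01 ->]; have s01' : 0 <= 1 - s <= 1 by lra.
rewrite (_ : _ - b = (1 - s) *: (x - b) + s *: (y - b)); last first.
  by apply: ptP; rewrite !coE; ring.
apply: le_lt_trans (nrmD _ _) _; rewrite !nrmZ01 //; exact: convex_lt.
Qed.

(** The direct move is degenerate when [b'] lies in the plane of [a], [b], [c]. A detour through a
    nearby point [b2], off that plane and off the plane of [a], [b'], [c], makes both moves
    generic. *)
Lemma kequiv_move a b c l h b' :
  (forall x, nrm (x - b) < h -> simple (a :: x :: c :: l)) -> nrm (b' - b) < h ->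
  knot_equiv (a :: b :: c :: l) (a :: b' :: c :: l).
Proof.
move=> S hb'.
have [n1 n10 [n1a n1c]] := perp2 (a - b) (c - b).
have [n2 n20 [n2a n2c]] := perp2 (a - b') (c - b').
have [w [w1 w2]] := off_two_planes n10 n20.
have h0 : 0 < h by apply: le_lt_trans (nrm_ge0 _) hb'.
have hb : nrm (b - b) < h by rewrite subrr nrm0.
have w0 := nrm_ge0 w.
have [r [r0 rh rn]] : exists r, [/\ 0 < r, r * nrm w < h & dot n2 (b - b') + r * dot n2 w != 0].
  pose r := h / (nrm w + 1) / 2.
  have r0 : 0 < r by rewrite /r !divr_gt0 //; lra.
  have rh : r * nrm w < h.
    have : r * (nrm w + 1) = h / 2 by rewrite /r; field; lra.
    lra.
  (* Only one value of [r] puts [b + r *: w] into the second plane; if it is this one, half of it is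
     safe. *)
  have [E|ne] := eqVneq (dot n2 (b - b') + r * dot n2 w) 0; last by exists r.
  exists (r / 2); split; [lra| |].
    by have : 0 <= r * nrm w by [rewrite mulr_ge0 // ltW]; lra.
  rewrite (_ : _ + _ = - (r * dot n2 w) / 2); last lra.
  by rewrite mulf_eq0 oppr_eq0 mulf_eq0 (negPf w2) (gt_eqF r0) invr_eq0 pnatr_eq0.
pose b2 := b + r *: w.
have hb2 : nrm (b2 - b) < h by rewrite addrC addKr nrmZ gtr0_norm.
apply: (kequiv_trans (q := a :: b2 :: c :: l)).
  apply: (@kequiv_move_generic _ _ _ _ _ _ n1) => //.
    by move=> z bz; apply: S; apply: ball_seg bz.
  by rewrite addrC addKr dotZr mulf_eq0 (gt_eqF r0).
apply: kequiv_sym; apply: (@kequiv_move_generic _ _ _ _ _ _ n2) => //.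
  by move=> z bz; apply: S; apply: ball_seg bz.
rewrite (_ : dot n2 (b2 - b') = dot n2 (b - b') + r * dot n2 w) //.
by rewrite /b2 /dot !coE; ring.
Qed.

(** The vertices move one at a time. The partial map [gs s], which moves those in [s] only, is as
    close to the identity as [g], so every intermediate polygon is simple. *)
Lemma kequiv_map_close p h : simple p ->
  (forall g : pt R -> pt R, (forall v, v \in p -> nrm (g v - v) < h) -> simple (map g p)) ->
  forall g : pt R -> pt R, (forall v, v \in p -> nrm (g v - v) < h) ->
  knot_equiv p (map g p).
Proof.
move=> sp S g hg; have [p3 up _ _] := sp.
have h0 : 0 < h.
  by case: p p3 hg {S sp up} => // x p _ /(_ x (mem_head _ _)); apply: le_lt_trans (nrm_ge0 _).
pose gs (s : seq (pt R)) v := if v \in s then g v else v.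
have gs_close s v : v \in p -> nrm (gs s v - v) < h.
  by rewrite /gs; case: ifP => // _ vp; [apply: hg | rewrite subrr nrm0].
suff H s : knot_equiv p (map (gs s) p).
  suff -> : map g p = map (gs p) p by apply: H.
  by apply/eq_in_map => v vp; rewrite /gs vp.
elim: s => [|v s IH]; first by rewrite map_id_in //; apply: kequiv_refl.
apply: kequiv_trans IH _.
have [vs|vs] := boolP (v \in s).
  have -> : map (gs (v :: s)) p = map (gs s) p; last exact: kequiv_refl.
  by apply/eq_in_map => w _; rewrite /gs inE; case: eqP => [->|]; rewrite ?vs.
have [vp|vp] := boolP (v \in p); last first.
  have -> : map (gs (v :: s)) p = map (gs s) p; last exact: kequiv_refl.
  by apply/eq_in_map => w wp; rewrite /gs inE; case: eqP => // E; rewrite -E wp in vp.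
have [i l' El] := rot_to vp.
have : (2 < size (rot i p))%N by rewrite size_rot.
rewrite El; case: l' El => [//|c l'] El; case/lastP: l' El => [//|l' a] El _.
have vl : v \notin c :: rcons l' a.
  by have : uniq (rot i p) by [rewrite rot_uniq]; rewrite El => /andP[].
have eqr s1 s2 : s1 =i s2 -> map (gs s1) p = map (gs s2) p.
  by move=> E; apply/eq_in_map => w _; rewrite /gs E.
have agree x : map (fun w => if w == v then x else gs s w) (rot i p) =
    x :: gs s c :: rcons (map (gs s) l') (gs s a).
  rewrite El /= eqxx map_rcons /=; move: vl; rewrite !inE mem_rcons inE !negb_or.
  case/and3P=> vc va vl'; rewrite ![_ == v]eq_sym (negPf vc) (negPf va); congr [:: _, _ & rcons _ _].
  by apply/eq_in_map => w wl; case: eqP => // E; rewrite -E wl in vl'.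
have sx x : nrm (x - v) < h -> simple (x :: gs s c :: rcons (map (gs s) l') (gs s a)).
  move=> xv; rewrite -agree map_rot; apply: simple_rot; apply: S => w wp.
  by case: eqP => [->|_]; [|apply: gs_close].
have s1 := S _ (gs_close s); have s2 := S _ (gs_close (v :: s)).
apply: kequiv_trans (kequiv_rot i s1) _; apply: kequiv_trans _ (kequiv_sym (kequiv_rot i s2)).
rewrite -!map_rot.
have -> : map (gs s) (rot i p) = v :: gs s c :: rcons (map (gs s) l') (gs s a).
  rewrite -agree; apply/eq_in_map => w _; case: eqP => // ->.
  by rewrite /gs (negPf vs).
have -> : map (gs (v :: s)) (rot i p) = g v :: gs s c :: rcons (map (gs s) l') (gs s a).
  by rewrite -agree; apply/eq_in_map => w _; rewrite /gs inE; case: eqP => // ->.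
set a' := gs s a in sx *; set c' := gs s c in sx *; set l := map _ l' in sx *.
have sx' x : nrm (x - v) < h -> simple (a' :: x :: c' :: l).
  by move/sx => /(simple_rot (size (x :: c' :: l))); rewrite -!rcons_cons -cats1 rot_size_cat.
have rw x : x :: c' :: rcons l a' = rot 1 (a' :: x :: c' :: l) by rewrite rot1_cons.
rewrite !rw; apply: kequiv_trans (kequiv_trans _ (kequiv_rot 1 _)); last 2 first.
- exact: kequiv_move sx' (hg _ vp).
- by apply: sx'; apply: hg.
by apply: kequiv_sym; apply: kequiv_rot; apply: sx'; rewrite subrr nrm0.
Qed.

Lemma kequiv_near (f : pt R -> pt R) p : uniq p -> simple (map f p) ->
  exists2 h, 0 < h & forall g : pt R -> pt R,
    (forall v, v \in p -> nrm (g v - f v) < h) -> knot_equiv (map f p) (map g p).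
Proof.
move=> up sp; have [h h0 H] := simple_stable sp; exists h => // g hg.
have uf : uniq (map f p) by case: sp.
have fi : {in p &, injective f}.
  move=> x y /(nthP 0)[i hi <-] /(nthP 0)[j hj <-] E; congr nth.
  by apply/eqP; rewrite -(nth_uniq 0 _ _ uf) ?size_map // !(nth_map 0) // E.
(* On the vertices [k] is [g] after the inverse of [f], which turns two nearby maps of [p] into one
   map near the identity on the image polygon. *)
pose k w := g (nth 0 p (index w (map f p))).
have kf v : v \in p -> k (f v) = g v.
  move=> vp; rewrite /k; congr g.
  have jp : (index (f v) (map f p) < size p)%N.
    by rewrite -(size_map f) index_mem map_f.
  apply: fi => //; first exact: mem_nth.
  by rewrite -(nth_map _ 0) // nth_index // map_f.
have -> : map g p = map k (map f p).
  by rewrite -map_comp; apply/eq_in_map => v vp /=; rewrite kf.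
apply: kequiv_map_close H _ _ => // _ /mapP[v vp ->]; rewrite kf //; exact: hg.
Qed.

(** A Lipschitz bound in time for each vertex is all the continuity required, since there are
    finitely many vertices; near each [t] all stages are equivalent to stage [t]. *)
Lemma kequiv_isotopy (F : R -> pt R -> pt R) p (L : pt R -> R) : uniq p ->
  (forall v, v \in p -> forall s t, 0 <= s <= 1 -> 0 <= t <= 1 ->
     nrm (F s v - F t v) <= L v * `|s - t|) ->
  (forall t, 0 <= t <= 1 -> simple (map (F t) p)) ->
  knot_equiv (map (F 0) p) (map (F 1) p).
Proof.
move=> up lip S; apply: (@interval_induction _ (fun s t => knot_equiv (map (F s) p) (map (F t) p))).
  by move=> r s t; apply: kequiv_trans.
move=> t t01; have [h h0 H] := kequiv_near up (S t t01).
have [||d d0 K] := @all_small R (pt R) p (fun r v => forall s : R, 0 <= s <= 1 -> `|s - t| < r ->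
    nrm (F s v - F t v) < h).
- by move=> r r' v rr K s s01 st; apply: K => //; apply: lt_le_trans rr.
- move=> v vp; exists (h / (`|L v| + 1)); first by rewrite divr_gt0 // ltr_wpDl.
  move=> s s01; rewrite ltr_pdivlMr ?ltr_wpDl // => st.
  apply: le_lt_trans (lip _ vp _ _ s01 t01) _; apply: le_lt_trans st.
  by rewrite mulrC ler_wpM2l // (le_trans (ler_norm _)) // lerDl.
exists d => // a b a0 b1 ad at_ tb bd.
apply: (kequiv_trans (q := map (F t) p)).
  by apply/kequiv_sym/H => v vp; apply: K; rewrite // ?ltr_norml; lra.
by apply: H => v vp; apply: K; rewrite // ?ltr_norml; lra.
Qed.

(** The segment [m, x] cuts the triangle into a fan from [a] and a fan from [b]. Rewriting the point
    in terms of [a], [m], [x] gives [m] the weight [t2 / s], and the comparison of [t2 * (1 - s)]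
    with [s * t1] says whether the weight left for [a] is nonnegative. *)
Lemma tri_fan_open a b m x y s : 0 < s < 1 -> m = (1 - s) *: a + s *: b ->
  tri a b x y -> exists2 z, seg m x z & seg a z y \/ seg z b y.
Proof.
have key a' b' s' t1 t2 t3 : 0 < s' < 1 -> 0 <= t1 -> 0 <= t2 -> 0 <= t3 ->
    t1 + t2 + t3 = 1 -> t2 * (1 - s') <= s' * t1 ->
    exists2 z, seg ((1 - s') *: a' + s' *: b') x z & seg a' z (t1 *: a' + t2 *: b' + t3 *: x).
  move=> s01 h1 h2 h3 E le.
  have s0 : 0 < s' by lra.
  pose r := t3 + t2 / s'.
  have t2s : 0 <= t2 / s' by rewrite divr_ge0 // ltW.
  have r01 : 0 <= r <= 1.
    rewrite /r addr_ge0 //= -lerBrDl ler_pdivrMr //; nra.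
  have [r0|r0] := eqVneq r 0.
    have t30 : t3 = 0 by rewrite /r in r0; lra.
    have t20 : t2 = 0.
      have t2s0 : t2 / s' = 0 by rewrite /r in r0; lra.
      by rewrite -(divfK (lt0r_neq0 s0) t2) t2s0 mul0r.
    exists ((1 - s') *: a' + s' *: b'); first exact: seg_l.
    rewrite t20 t30 !scale0r !addr0 (_ : t1 = 1) ?scale1r; [exact: seg_l|lra].
  have r0' : 0 < r by rewrite lt0r r0; lra.
  exists ((1 - t3 / r) *: ((1 - s') *: a' + s' *: b') + (t3 / r) *: x).
    exists (t3 / r) => //; rewrite divr_ge0 ?ler_pdivrMr //; rewrite /r; lra.
  exists r => //.
  rewrite scalerDr !scalerA (_ : r * (1 - t3 / r) = t2 / s'); last first.
    by rewrite mulrBr mulr1 mulrCA divff // mulr1 /r addrC addKr.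
  rewrite (_ : r * (t3 / r) = t3); last by rewrite mulrC divfK.
  rewrite scalerDr !scalerA divfK ?gt_eqF // addrA addrA -scalerDl.
  congr (_ *: _ + _ + _); rewrite /r (_ : t1 = 1 - t2 - t3); last lra.
  by field; rewrite gt_eqF.
move=> s01 -> [t1 [t2 [t3 [h1 h2 h3 E ->]]]].
have [le|/ltW le] := leP (t2 * (1 - s)) (s * t1).
  by have [z z1 z2] := key a b _ _ _ _ s01 h1 h2 h3 E le; exists z => //; left.
have s01' : 0 < 1 - s < 1 by lra.
have [||z z1 z2] := key b a _ t2 t1 t3 s01' h2 h1 h3; first lra.
  by rewrite subKr mulrC [(1 - s) * _]mulrC.
exists z; first by move: z1; rewrite subKr addrC.
by right; apply: segC; rewrite [t1 *: a + _]addrC.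
Qed.

Lemma simple_subdivide a b l m s : 0 < s < 1 -> m = (1 - s) *: a + s *: b ->
  simple (a :: b :: l) -> simple (a :: m :: b :: l).
Proof.
move=> s01 Em sp; have [p3 up H2 H3] := sp.
have abp : (a, b) \in edges (a :: b :: l) by rewrite edges_cons2 mem_head.
have ab : a != b by move: up; rewrite /= inE negb_or => /andP[/andP[]].
have inj t r : (1 - t) *: a + t *: b = (1 - r) *: a + r *: b -> t = r.
  move=> /eqP; rewrite -subr_eq0 (_ : _ - _ = (r - t) *: (a - b)); last first.
    by apply: ptP; rewrite !coE; ring.
  by rewrite scaler_eq0 !subr_eq0 (negPf ab) orbF eq_sym => /eqP.
have a1 t : t *: m + (1 - t) *: a = (1 - t * s) *: a + (t * s) *: b.
  by rewrite Em; apply: ptP; rewrite !coE; ring.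
have b1 t : t *: m + (1 - t) *: b = (1 - (1 - t * (1 - s))) *: a + (1 - t * (1 - s)) *: b.
  by rewrite Em; apply: ptP; rewrite !coE; ring.
have aE : a = (1 - 0) *: a + 0 *: b by rewrite subr0 scale1r scale0r addr0.
have bE : b = (1 - 1) *: a + 1 *: b by rewrite subrr scale1r scale0r add0r.
have am y : seg a m y -> exists2 t, 0 <= t <= s & y = (1 - t) *: a + t *: b.
  case=> t t01 ->; exists (t * s); last by rewrite addrC a1.
  by rewrite mulr_ge0 /=; [nra|lra|lra].
have mb y : seg m b y -> exists2 t, s <= t <= 1 & y = (1 - t) *: a + t *: b.
  move=> /segC[t t01 ->]; exists (1 - t * (1 - s)); last by rewrite addrC b1.
  apply/andP; split; nra.
have sab y t : 0 <= t <= 1 -> y = (1 - t) *: a + t *: b -> seg a b y.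
  by move=> t01 ->; exists t.
apply: simple_insert => //.
- by apply/eqP => E; move: Em; rewrite {1}E {1}aE => /inj; lra.
- by apply/eqP => E; move: Em; rewrite {1}E {1}bE => /inj; lra.
- move=> y /am[t t01 ->] /mb[r r01] /inj E; rewrite Em; congr (_ *: _ + _ *: _); lra.
- move=> e y ep /am[t t01 Ey] ye.
  have ys : seg a b y by apply: sab Ey; lra.
  have [E|ne] := eqVneq e.1 b; last exact: shared_l sp ep ne ys ye.
  have : y = b by rewrite -E; apply: (H2 _ _ abp (path_edges_subset ep)).
  rewrite {1}Ey {2}bE => /inj t1; exfalso; lra.
- move=> e y ep /mb[t t01 Ey] ye.
  have ys : seg a b y by apply: sab Ey; lra.
  have [E|ne] := eqVneq e.2 a; last exact: shared_r sp ep ne ys ye.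
  have : y = a by apply: (H2 _ _ (path_edges_subset ep) abp).
  rewrite {1}Ey {2}aE => /inj t1; exfalso; lra.
Qed.

(** A triangle move cannot insert a point of [a, b] itself, collinear triples being excluded. The
    vertex is inserted at a point [x] near [m] off the line and then moved to [m]. The triangle is
    free of other edges since each of its points lies on a simple polygon through some [z] near
    [m]. *)
Lemma kequiv_subdivide a b l m s : 0 < s < 1 -> m = (1 - s) *: a + s *: b ->
  simple (a :: b :: l) -> knot_equiv (a :: b :: l) (a :: m :: b :: l).
Proof.
move=> s01 Em sp; have sm := simple_subdivide s01 Em sp.
have [h h0 H] := simple_stable sm.
have [_ um _ _] := sm.
have [p3 up _ _] := sp.
have ab : a != b by move: up; rewrite /= inE negb_or => /andP[/andP[]].
have S x : nrm (x - m) < h -> simple (a :: x :: b :: l).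
  move=> xm; have := H (fun v => if v == m then x else v).
  rewrite /= eqxx; move: um; rewrite /= !inE !negb_or => /and3P[/and3P[am _ _] /andP[mb ml] _].
  rewrite (negPf am) [b == m]eq_sym (negPf mb) map_id_in; first apply.
    by move=> v _; case: eqP => [->//|_]; rewrite subrr nrm0.
  by move=> v vl; case: eqP => // E; rewrite -E vl in ml.
have [n n0 [na _]] := perp2 (a - b) 0.
pose x := m + (h / 2 / (nrm n + 1)) *: n.
have n1 := nrm_ge0 n.
have r0 : 0 < h / 2 / (nrm n + 1) by rewrite !divr_gt0 //; lra.
have hx : nrm (x - m) < h.
  rewrite addrC addKr nrmZ gtr0_norm //.
  have : h / 2 / (nrm n + 1) * (nrm n + 1) = h / 2 by field; lra.
  lra.
apply: (kequiv_trans (q := a :: x :: b :: l)); last exact/kequiv_sym/(kequiv_move S hx).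
apply: kequiv_delta; rewrite //; first exact: S.
  move=> [t E]; have : dot n (x - a) = 0.
    by rewrite E dotZr -(opprB a b) dotNr na oppr0 mulr0.
  rewrite (_ : x - a = s *: (b - a) + (x - m)); last by rewrite Em; apply: ptP; rewrite !coE; ring.
  rewrite dotDr dotZr -(opprB a b) dotNr na oppr0 mulr0 add0r addrC addKr dotZr.
  by move=> /eqP; rewrite mulf_eq0 !gt_eqF // dotvv_gt0.
move=> e; rewrite edges_cons2 inE => /orP[/eqP->//|ep] y ty ye.
have [z z1 z2] := tri_fan_open s01 Em ty.
have mm : nrm (m - m) < h by rewrite subrr nrm0.
have sz := S z (ball_seg mm hx z1); have [_ uz _ _] := sz.
case: z2 => ys.
  rewrite (_ : y = a); first exact: seg_l.
  apply: (shared_l sz _ _ ys ye); first by rewrite path_edges_cons inE ep orbT.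
  by apply: contraTneq (path_edges1 ep) => ->; case/and3P: uz.
rewrite (_ : y = b); first exact: seg_r.
have sz' := simple_rot 1 sz; rewrite rot1_cons in sz'.
apply: (shared_r sz' _ _ ys ye); first by rewrite path_edges_rcons mem_rcons inE ep orbT.
apply: contraTneq (path_edges2 ep) => ->.
by move: uz; rewrite /= !inE !negb_or eq_sym => /and3P[/and3P[-> _ _] /andP[_ ->] _].
Qed.

End Isotopy.

(** * Regular diagrams under maps and subdivision *)

Section Diagrams.
Variable R : realType.
Implicit Types (p q : seq (pt R)) (e f g : pt R * pt R) (a b c d x y z m v w : pt R).
Implicit Types (h F : pt R -> pt R).

(** Regularity in terms of the relation [h x = h y] alone: two projections with the same fibres on
    the polygon are interchangeable. *)
Definition regular h p := [/\
  (forall v w, v \in p -> w \in p -> h v = h w -> v = w),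
  (forall e f, e \in edges p -> f \in edges p -> e.2 = f.1 ->
     forall x y, on e x -> on f y -> h x = h y -> h x = h f.1),
  (forall e f, e \in edges p -> f \in edges p -> nonadj e f -> forall x y x' y',
     on e x -> on f y -> h x = h y -> on e x' -> on f y' -> h x' = h y' -> h x = h x'),
  (forall e f, e \in edges p -> f \in edges p -> nonadj e f -> forall x y,
     on e x -> on f y -> h x = h y -> forall v, v \in p -> h x <> h v) &
  (forall e f g, e \in edges p -> f \in edges p -> g \in edges p ->
     e.1 != f.1 -> f.1 != g.1 -> e.1 != g.1 -> forall x y z,
     on e x -> on f y -> on g z -> h x = h y -> h x = h z -> False)].

Lemma mem_edge p i : (i < size p)%N -> (vtx p i, vtx p i.+1) \in edges p.
Proof. by move=> hi; apply/mem_edges; exists i. Qed.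

Lemma nonadj_idx p i j : uniq p -> (i < size p)%N -> (j < size p)%N ->
  nonadj (vtx p i, vtx p i.+1) (vtx p j, vtx p j.+1) -> i != j /\ ~ adjacent p i j.
Proof.
move=> up hi hj ne; have ij : i != j.
  by apply: contraTneq ne => ->; rewrite /nonadj eqxx.
by split=> //; apply/adjacentP.
Qed.

Lemma regular_projW h p : simple p -> regular_proj h p -> regular h p.
Proof.
move=> [p3 up _ _] [H1 H2 H3 H4 H5].
have vi i j : (i < size p)%N -> (j < size p)%N -> h (vtx p i) = h (vtx p j) -> i = j.
  move=> hi hj E; apply/eqP/contraT => ij.
  have [|na] := pselect (adjacent p i j).
    case=> A; first by have := H1 i hi; rewrite -[vtx p i.+1]vtx_mod -A E eqxx.
    by have := H1 j hj; rewrite -[vtx p j.+1]vtx_mod -A E eqxx.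
  have pi_i : piece h p i (h (vtx p i)) by exists (vtx p i) => //; apply: seg_l.
  have pj_i : piece h p j (h (vtx p i)) by exists (vtx p j) => //; apply: seg_l.
  by have := H4 i j hi hj ij na _ pi_i pj_i i hi; rewrite eqxx.
split.
- by move=> _ _ /memP_vtx[i hi ->] /memP_vtx[j hj ->] /vi ->.
- move=> _ _ /mem_edges[i hi ->] /mem_edges[j hj ->] /= /(vtxS_inj up hi hj) ij x y ex ey E.
  by apply: (H2 i j) => //; [exists x | exists y].
- move=> _ _ /mem_edges[i hi ->] /mem_edges[j hj ->] /(nonadj_idx up hi hj)[ij na].
  move=> x y x' y' ex ey E ex' ey' E'.
  by apply: (H3 i j) => //; [exists x|exists y|exists x'|exists y'].
- move=> _ _ /mem_edges[i hi ->] /mem_edges[j hj ->] /(nonadj_idx up hi hj)[ij na].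
  move=> x y ex ey E _ /memP_vtx[l hl ->]; apply/eqP.
  by apply: (H4 i j) => //; [exists x | exists y].
- move=> _ _ _ /mem_edges[i hi ->] /mem_edges[j hj ->] /mem_edges[l hl ->] /= ij jl il.
  move=> x y z ex ey ez E E'; apply: (H5 i j l) => //.
  + by apply: contraNneq ij => ->.
  + by apply: contraNneq jl => ->.
  + by apply: contraNneq il => ->.
  + by exists (h x); split; [exists x|exists y|exists z].
Qed.

Lemma regular_projI h p : simple p -> regular h p -> regular_proj h p.
Proof.
move=> [p3 up _ _] [H1 H2 H3 H4 H5].
have p2 : (1 < size p)%N by apply: ltnW.
have p0 : (0 < size p)%N by apply: ltnW.
have vi i j : (i < size p)%N -> (j < size p)%N -> i != j -> vtx p i != vtx p j.
  by move=> hi hj; apply: contra_neq => /(vtx_inj up hi hj).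
split.
- move=> i hi; apply/eqP => /H1; rewrite !mem_vtx // => /(_ isT isT)/eqP.
  by apply/negP; apply: (edges_neq p2 up (mem_edge hi)).
- move=> i j hi hj ij _ [x ex ->] [y ey E].
  by apply: (H2 _ _ (mem_edge hi) (mem_edge hj) _ x y) => //=; rewrite {1}ij vtx_mod.
- move=> i j hi hj ij /(adjacentP up hi hj ij) na _ _ [x ex ->] [y ey E] [x' ex' ->] [y' ey' E'].
  exact: (H3 _ _ (mem_edge hi) (mem_edge hj) na x y x' y').
- move=> i j hi hj ij /(adjacentP up hi hj ij) na _ [x ex ->] [y ey E] l hl; apply/eqP.
  by apply: (H4 _ _ (mem_edge hi) (mem_edge hj) na x y) => //; apply: mem_vtx.
- move=> i j l hi hj hl ij jl il [_ [[x ex ->] [y ey E] [z ez E']]].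
  apply: (H5 _ _ _ (mem_edge hi) (mem_edge hj) (mem_edge hl) _ _ _ x y z) => //=; exact: vi.
Qed.

Lemma regular_rot h n p : regular h p -> regular h (rot n p).
Proof.
case=> H1 H2 H3 H4 H5; split.
- by move=> v w; rewrite !mem_rot; apply: H1.
- by move=> e f; rewrite !mem_edges_rot; apply: H2.
- by move=> e f; rewrite !mem_edges_rot; apply: H3.
- move=> e f; rewrite !mem_edges_rot => ep fp n1 x y ex fy E v; rewrite mem_rot.
  exact: (H4 e f ep fp n1 x y).
- by move=> e f g; rewrite !mem_edges_rot; apply: H5.
Qed.

(** This inclusion is the one that matters: each point of the straight new edge must be pulled back
    to the old edge. *)
Definition seg_cover F e := forall y, seg (F e.1) (F e.2) y -> exists2 x, on e x & y = F x.

(** Every clause is pulled back along [F], proved for [h] and pushed forward again by the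
    equivalence of the two relations. *)
Lemma regular_map h h' F p : regular h p ->
  (forall e f, e \in edges p -> f \in edges p -> forall x y, on e x -> on f y ->
     h' (F x) = h' (F y) <-> h x = h y) ->
  (forall e, e \in edges p -> seg_cover F e) ->
  regular h' (map F p).
Proof.
move=> [H1 H2 H3 H4 H5] K C.
have es1 v : v \in p -> exists2 e, e \in edges p & v = e.1.
  by case/memP_vtx=> i hi ->; exists (vtx p i, vtx p i.+1) => //; apply: mem_edge.
have o1 e : on e e.1 by apply: seg_l.
have o2 e : on e e.2 by apply: seg_r.
have nF e f : nonadj (F e.1, F e.2) (F f.1, F f.2) -> nonadj e f.
  move=> /and3P[n1 n2 n3]; apply/and3P.
  by split; [apply: contra n1|apply: contra n2|apply: contra n3] => /eqP ->.
have V v w : v \in p -> w \in p -> h' (F v) = h' (F w) -> v = w.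
  by move=> vp wp; have [[e ep Ev] [f fp Ew]] := (es1 v vp, es1 w wp);
    rewrite Ev Ew => /(K e f ep fp) E; rewrite -Ev -Ew; apply: H1 => //; rewrite Ev Ew E.
split.
- by move=> _ _ /mapP[v vp ->] /mapP[w wp ->] /V ->.
- rewrite edges_map => _ _ /mapP[e ep ->] /mapP[f fp ->] /= E _ _ /(C e ep)[x ex ->] /(C f fp)[y ey ->].
  have {}E : e.2 = f.1 by apply: V; [apply: edges_mem2 ep|apply: edges_mem1 fp|rewrite E].
  move=> /(K e f ep fp _ _ ex ey) Exy.
  apply/(K e f ep fp _ _ ex (o1 f)); exact: (H2 e f ep fp E x y).
- rewrite edges_map => _ _ /mapP[e ep ->] /mapP[f fp ->] /nF nef.
  move=> x1 y1 x2 y2 /(C e ep)[x ex ->] /(C f fp)[y ey ->] /(K e f ep fp _ _ ex ey) E.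
  move=> /(C e ep)[x' ex' ->] /(C f fp)[y' ey' ->] /(K e f ep fp _ _ ex' ey') E'.
  apply/(K e e ep ep _ _ ex ex'); exact: (H3 e f ep fp nef x y x' y').
- rewrite edges_map => _ _ /mapP[e ep ->] /mapP[f fp ->] /nF nef.
  move=> _ _ /(C e ep)[x ex ->] /(C f fp)[y ey ->] /(K e f ep fp _ _ ex ey) E.
  move=> _ /mapP[v vp ->]; have [g gp Ev] := es1 v vp.
  by rewrite Ev => /(K e g ep gp _ _ ex (o1 g)); rewrite -Ev; apply: (H4 e f ep fp nef x y).
- rewrite edges_map => _ _ _ /mapP[e ep ->] /mapP[f fp ->] /mapP[g gp ->] /= n1 n2 n3.
  move=> _ _ _ /(C e ep)[x ex ->] /(C f fp)[y ey ->] /(C g gp)[z ez ->].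
  move=> /(K e f ep fp _ _ ex ey) E /(K e g ep gp _ _ ex ez) E'.
  apply: (H5 e f g ep fp gp _ _ _ x y z) => //.
  + by apply: contra n1 => /eqP ->.
  + by apply: contra n2 => /eqP ->.
  + by apply: contra n3 => /eqP ->.
Qed.

Lemma simple_map F p : simple p ->
  (forall e f, e \in edges p -> f \in edges p -> forall x y, on e x -> on f y -> F x = F y -> x = y) ->
  (forall e, e \in edges p -> seg_cover F e) ->
  simple (map F p).
Proof.
move=> [p3 up H2 H3] K C.
have es1 v : v \in p -> exists2 e, e \in edges p & v = e.1.
  by case/memP_vtx=> i hi ->; exists (vtx p i, vtx p i.+1) => //; apply: mem_edge.
have o1 e : on e e.1 by apply: seg_l.
have V v w : v \in p -> w \in p -> F v = F w -> v = w.
  by move=> /es1[e ep ->] /es1[f fp ->]; apply: (K e f).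
split; rewrite ?size_map // ?map_inj_in_uniq //.
- rewrite edges_map => _ _ /mapP[e ep ->] /mapP[f fp ->] /= E _ /(C e ep)[x ex ->] /(C f fp)[y ey].
  have {}E : e.2 = f.1 by apply: V; [apply: edges_mem2 ep|apply: edges_mem1 fp|rewrite E].
  move=> /(K e f ep fp _ _ ex ey) Exy; rewrite -Exy in ey.
  by rewrite (H2 e f ep fp E x).
- rewrite edges_map => _ _ /mapP[e ep ->] /mapP[f fp ->] nef _ /(C e ep)[x ex ->] /(C f fp)[y ey].
  move=> /(K e f ep fp _ _ ex ey) Exy; rewrite -Exy in ey; apply: (H3 e f ep fp _ x ex ey).
  move: nef => /and3P[n1 n2 n3]; apply/and3P.
  by split; [apply: contra n1|apply: contra n2|apply: contra n3] => /eqP ->.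
Qed.

(* par sends an edge of the subdivided polygon to the original edge containing it. *)
Lemma nonadj_subdivide h a b l m s : 0 < s < 1 -> m = (1 - s) *: a + s *: b ->
  simple (a :: b :: l) -> regular h (a :: b :: l) ->
  (forall x y, seg a b x -> seg a b y -> h x = h y -> x = y) ->
  exists par : pt R * pt R -> pt R * pt R,
  [/\ forall e, e \in edges (a :: m :: b :: l) ->
        par e = (a, b) /\ (e = (a, m) \/ e = (m, b)) \/ par e = e /\ e \in path_edges b l a,
      forall e, e \in edges (a :: m :: b :: l) -> forall x, on e x -> on (par e) x
    & forall e f, e \in edges (a :: m :: b :: l) -> f \in edges (a :: m :: b :: l) ->
      nonadj e f -> forall x y, on e x -> on f y -> h x = h y ->  nonadj (par e) (par f)].
Proof.
move=> s01 Em sp [H1 H2 _ _ _] inj.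
have sm := simple_subdivide s01 Em sp.
have [_ up _ _] := sp; have [_ um _ _] := sm.
have ab : a != b by move: up; rewrite /= inE negb_or => /andP[/andP[]].
have /and3P[am bm ml] : [&& a != m, b != m & m \notin l].
  move: um; rewrite /= !inE !negb_or => /and3P[/and3P[-> _ _] /andP[mb ->] _].
  by rewrite eq_sym mb.
have sm_ab x : seg a m x -> seg a b x.
  case=> t t01 ->; exists (t * s).
    by apply/andP; split; [rewrite mulr_ge0 //|]; nra.
  by rewrite Em; apply: ptP; rewrite !coE; ring.
have mb_ab x : seg m b x -> seg a b x.
  move=> /segC[t t01 ->]; apply: segC; exists (t * (1 - s)).
    by apply/andP; split; [rewrite mulr_ge0 //|]; nra.
  by rewrite Em; apply: ptP; rewrite !coE; ring.
have bab : (a, b) \in edges (a :: b :: l) by rewrite edges_cons2 mem_head.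
have E : edges (a :: m :: b :: l) = (a, m) :: (m, b) :: path_edges b l a by rewrite edges_cons2 path_edges_cons.
have pm e : e \in path_edges b l a -> (e.1 != a) && (e.1 != m).
  move=> ep; apply/andP; split; apply: contraTneq (path_edges1 ep) => ->; first by case/andP: up.
  by rewrite inE negb_or eq_sym bm.
have corner x : seg a m x -> seg m b x -> x = m.
  by have [_ _ K _] := sm; apply: (K (a, m) (m, b)); rewrite ?E ?inE ?eqxx ?orbT.
pose par e := if (e == (a, m)) || (e == (m, b)) then (a, b) else e.
have parE e : e \in path_edges b l a -> par e = e.
  move=> /pm/andP[n1 n2]; rewrite /par; case: eqP => [Ee|_]; first by rewrite Ee eqxx in n1.
  by case: eqP => [Ee|//]; rewrite Ee eqxx in n2.
have par1 : par (a, m) = (a, b) by rewrite /par eqxx.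
have par2 : par (m, b) = (a, b) by rewrite /par eqxx orbT.
(* Subdivision makes some adjacent edges non-adjacent, for example [a, m] and the edge from [b].
   These have no common image: adjacency confined it to the image of [b], and [b] is not on
   [a, m]. *)
have key e f : (e = (a, m) \/ e = (m, b)) -> f \in path_edges b l a -> nonadj e f ->
    forall x y, on e x -> on f y -> h x = h y -> nonadj (a, b) f.
  move=> ce fp /and3P[n1 n2 n3] x y ex fy Exy; have /andP[fa fm] := pm _ fp.
  have xab : seg a b x by case: ce ex => ->; [apply: sm_ab|apply: mb_ab].
  apply/and3P; split => /=; first by rewrite eq_sym.
  - case: ce ex n2 => -> ex //= _; apply/eqP => Ef.
    have Ex : x = b.
      apply: inj => //; first exact: seg_r.
      by rewrite Ef; apply: (H2 (a, b) f bab (path_edges_subset fp) Ef x y).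
    by move/eqP: bm; apply; apply: corner; rewrite -?Ex //; rewrite Ex; apply: seg_r.
  - case: ce ex n3 => -> ex //= _; apply/eqP => Ef.
    have Ex : x = a.
      apply: inj => //; first exact: seg_l.
      by rewrite Exy; apply: (H2 f (a, b) (path_edges_subset fp) bab Ef y x).
    by move/eqP: am; apply; apply: corner; rewrite -?Ex //; rewrite Ex; apply: seg_l.
exists par; split.
- move=> e; rewrite E !inE => /or3P[/eqP->|/eqP->|ep]; [left|left|right].
  + by rewrite par1; split=> //; left.
  + by rewrite par2; split=> //; right.
  + by rewrite parE.
- move=> e; rewrite E !inE => /or3P[/eqP->|/eqP->|ep] x.
  + by rewrite par1; apply: sm_ab.
  + by rewrite par2; apply: mb_ab.
  + by rewrite parE.
- move=> e f; rewrite !E !inE => /or3P[/eqP->|/eqP->|ep] /or3P[/eqP->|/eqP->|fp].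
  + by rewrite /nonadj eqxx.
  + by rewrite /nonadj /= eqxx andbF.
  + by rewrite par1 parE //; apply: key => //; left.
  + by rewrite /nonadj /= eqxx !andbF.
  + by rewrite /nonadj eqxx.
  + by rewrite par2 parE //; apply: key => //; right.
  + move=> n1 x y ex ey Exy; rewrite par1 parE // nonadjC.
    by apply: (key (a, m) e _ ep _ y x) => //; [left|rewrite nonadjC].
  + move=> n1 x y ex ey Exy; rewrite par2 parE // nonadjC.
    by apply: (key (m, b) e _ ep _ y x) => //; [right|rewrite nonadjC].
  + by rewrite !parE // => n x y.
Qed.

(** A violation among new edges passes by [par] to the old ones, except for the new vertex, whose
    image avoids the other edges by hypothesis, and for triples that contain both halves of
    [a, b]. *)
Lemma regular_subdivide h a b l m s : 0 < s < 1 -> m = (1 - s) *: a + s *: b ->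
  simple (a :: b :: l) -> regular h (a :: b :: l) ->
  (forall x y, seg a b x -> seg a b y -> h x = h y -> x = y) ->
  (forall e, e \in path_edges b l a -> forall y, on e y -> h m <> h y) ->
  regular h (a :: m :: b :: l).
Proof.
move=> s01 Em sp rp inj nm; have [par [P1 P2 P3]] := nonadj_subdivide s01 Em sp rp inj.
have sm := simple_subdivide s01 Em sp.
have [H1 H2 H3 H4 H5] := rp.
have [_ up _ _] := sp; have [_ um corner _] := sm.
have bab : (a, b) \in edges (a :: b :: l) by rewrite edges_cons2 mem_head.
have E : edges (a :: m :: b :: l) = (a, m) :: (m, b) :: path_edges b l a by rewrite edges_cons2 path_edges_cons.
have /and3P[am bm ml] : [&& a != m, b != m & m \notin l].
  move: um; rewrite /= !inE !negb_or => /and3P[/and3P[-> _ _] /andP[mb ->] _].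
  by rewrite eq_sym mb.
have am_in : (a, m) \in edges (a :: m :: b :: l) by rewrite E mem_head.
have mb_in : (m, b) \in edges (a :: m :: b :: l) by rewrite E !inE eqxx orbT.
have mab : seg a b m by exists s; [lra|].
have par_es e : e \in edges (a :: m :: b :: l) -> par e \in edges (a :: b :: l).
  by move=> /P1[[-> _] //|[-> /path_edges_subset]].
have nmp v : v \in a :: b :: l -> h m <> h v.
  move=> /memP_vtx[i hi ->].
  have := mem_edge hi; rewrite edges_cons2 inE => /orP[/eqP[-> _] E0|/nm]; last by apply; apply: seg_l.
  by move/eqP: am; apply; apply/esym/inj => //; apply: seg_l.
have inq v : v \in a :: m :: b :: l -> v = m \/ v \in a :: b :: l.
  rewrite !inE => /or4P[/eqP->|/eqP->|/eqP->|->]; rewrite ?eqxx ?orbT; by [left|right].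
have inpe e : e \in edges (a :: m :: b :: l) -> par e != (a, b) -> e \in path_edges b l a.
  by move=> /P1[[-> _]|[]//]; rewrite eqxx.
have o1 e : on e e.1 by apply: seg_l.
have o2 e : on e e.2 by apply: seg_r.
have pem e : e \in path_edges b l a -> (e.1 != m) && (e.2 != m).
  by move=> ep; apply/andP; split; apply/eqP => Ee; case: (nm e ep m) => //; rewrite -Ee.
have Qam x : on (a, m) x -> on (a, b) x.
  have [[P _]|[_ /pem]] := P1 _ am_in; last by rewrite eqxx andbF.
  by move=> /(P2 _ am_in); rewrite P.
have Qmb x : on (m, b) x -> on (a, b) x.
  have [[P _]|[_ /pem]] := P1 _ mb_in; last by rewrite eqxx.
  by move=> /(P2 _ mb_in); rewrite P.
split.
- move=> v w /inq[->|vp] /inq[->|wp] // Evw; last exact: H1.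
  + by case: (nmp w).
  + by case: (nmp v).
- move=> e f; rewrite !E !inE => /or3P[/eqP->|/eqP->|ep] /or3P[/eqP->|/eqP->|fp] /=.
  + by move/eqP; rewrite eq_sym (negPf am).
  + move=> _ x y ex ey Exy; congr h; apply: (corner _ _ am_in mb_in) => //.
    have -> // : x = y.
    by apply: inj => //; [apply: Qam|apply: Qmb].
  + by move/eqP; rewrite eq_sym; case/andP: (pem _ fp) => /negPf->.
  + by move=> Eba; move: up; rewrite Eba /= inE eqxx.
  + by move/eqP; rewrite (negPf bm).
  + by move=> Ef x y ex; apply: (H2 (a, b) f bab (path_edges_subset fp) Ef); apply: Qmb.
  + move=> Ee x y ex ey; apply: (H2 e (a, b) (path_edges_subset ep) bab Ee x y ex).
    exact: Qam.
  + by move/eqP; case/andP: (pem _ ep) => _ /negPf->.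
  + exact: H2 (path_edges_subset ep) (path_edges_subset fp).
- move=> e f ep fp nef x y x' y' ex ey Exy ex' ey' Exy'.
  have np := P3 _ _ ep fp nef _ _ ex ey Exy.
  exact: (H3 _ _ (par_es _ ep) (par_es _ fp) np x y x' y' (P2 _ ep _ ex) (P2 _ fp _ ey) Exy
    (P2 _ ep _ ex') (P2 _ fp _ ey') Exy').
- move=> e f ep fp nef x y ex ey Exy v.
  have np := P3 _ _ ep fp nef _ _ ex ey Exy.
  move=> /inq[->|]; last first.
    exact: (H4 _ _ (par_es _ ep) (par_es _ fp) np x y (P2 _ ep _ ex) (P2 _ fp _ ey) Exy).
  have [E1|n1] := eqVneq (par e) (a, b); last by move=> Ex; apply: (nm e (inpe _ ep n1) x ex).
  have [E2|n2] := eqVneq (par f) (a, b); first by move: np; rewrite E1 E2 /nonadj eqxx.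
  by move=> Ex; apply: (nm f (inpe _ fp n2) y ey); rewrite -Exy.
- move=> e f g ep fp gp n1 n2 n3 x y z ex ey ez Exy Exz.
  (* The two halves share an image only at [m], so a triple point on both would put the image of [m]
     on a third edge. *)
  have twin e' f' g' x' y' z' : e' \in edges (a :: m :: b :: l) -> f' \in edges (a :: m :: b :: l) ->
      g' \in edges (a :: m :: b :: l) -> e'.1 != f'.1 -> g'.1 != e'.1 -> g'.1 != f'.1 ->
      on e' x' -> on f' y' -> on g' z' -> h x' = h y' -> h x' = h z' -> par e' = par f' -> False.
    move=> ep' fp' gp' m1 m2 m3 ex' ey' ez' Exy' Exz' Ep.
    have Ex : e' <> f' by move=> Ef; rewrite Ef eqxx in m1.
    have [cs|[P e'p]] := P1 _ ep'; last first.
      have [cs|[P' f'p]] := P1 _ fp'; last by rewrite -P Ep P' in Ex.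
      have := path_edges1 e'p; rewrite -P Ep; case: cs => -> _ /=.
      by case/andP: up => /negPf->.
    have [cs'|[P' f'p]] := P1 _ fp'; last first.
      have := path_edges1 f'p; rewrite -P' -Ep; case: cs => -> _ /=.
      by case/andP: up => /negPf->.
    case: cs cs' => P ce [P' cf].
    have Exy'' : x' = y'.
      by apply: inj => //; [have := P2 _ ep' _ ex'; rewrite P|have := P2 _ fp' _ ey'; rewrite P'].
    have Exm : x' = m.
      by case: ce cf Ex ex' ey' => -> [] -> // _; rewrite -Exy''; [|move=> K1 K2; move: K2 K1];
        apply: (corner _ _ am_in mb_in).
    have g'p : g' \in path_edges b l a.
      have [[_ cg]|[//]] := P1 _ gp'; move: m2 m3 Ex.
      by case: ce cf cg => -> [] -> [] -> //=; rewrite eqxx.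
    by apply: (nm g' g'p z' ez'); rewrite -Exm.
  have [E1|n1'] := eqVneq (par e) (par f).
    by apply: (twin e f g x y z) => //; rewrite eq_sym.
  have [E2|n2'] := eqVneq (par f) (par g).
    by apply: (twin f g e y z x) => //; rewrite -Exy.
  have [E3|n3'] := eqVneq (par e) (par g).
    by apply: (twin e g f x z y) => //; rewrite eq_sym.
  have d1 e' f' : e' \in edges (a :: m :: b :: l) -> f' \in edges (a :: m :: b :: l) ->
      par e' != par f' -> (par e').1 != (par f').1.
    by move=> ep' fp'; apply: contra_neq; apply: edges_inj1 up (par_es _ ep') (par_es _ fp').
  apply: (H5 _ _ _ (par_es _ ep) (par_es _ fp) (par_es _ gp) _ _ _ x y z (P2 _ ep _ ex)
    (P2 _ fp _ ey) (P2 _ gp _ ez) Exy Exz); exact: d1.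
Qed.

End Diagrams.

(** * Radial projection and generic directions *)

Section Sphere.
Variable R : realType.
Implicit Types (p q : seq (pt R)) (e f g : pt R * pt R) (a b c x y m v : pt R).

Lemma sdirE x : sdir x = (Num.sqrt (dot x x))^-1 *: x.
Proof.
rewrite /sdir /dot !big_ord_recl big_ord0 addr0 addrA -!expr2; congr ((Num.sqrt _)^-1 *: _).
by congr (_ ^+ 2 + _ ^+ 2 + _ ^+ 2); congr (x _ _); apply: val_inj.
Qed.

Lemma entryE x i (j : 'I_3) : x i j = nth 0 [:: cx x; cy x; cz x] j.
Proof.
rewrite (ord1 i); case: j => -[|[|[|//]]] Hj /=; congr (x _ _); exact: val_inj.
Qed.

Lemma coplanar0E a b c : coplanar0 a b c <-> dot (cross a b) c = 0.
Proof.
rewrite /coplanar0; set A := \matrix_(i, j) _; suff -> : \det A = dot (cross a b) c by [].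
have AE i j : A i j = nth 0 [:: a; b; c] i 0 j by rewrite mxE.
rewrite (expand_det_row _ ord0) !big_ord_recl big_ord0 addr0 /cofactor.
rewrite !(expand_det_row _ ord0) !big_ord_recl !big_ord0 !addr0 /cofactor !det_mx11.
rewrite !mxE /= !entryE /= /bump /= !(expr0, expr1, mul1r) /dot /cross !coE.
rewrite !(addn0, add0n, addn1, expr0, expr1, sqrrN, expr1n) /=; ring.
Qed.

Lemma sdir_scale l x : 0 < l -> sdir (l *: x) = sdir x.
Proof.
move=> l0; rewrite !sdirE scalerA dotZr [dot (l *: _) _]dotC dotZr mulrA -expr2.
rewrite sqrtrM ?sqr_ge0 // sqrtr_sqr gtr0_norm // invfM mulrAC mulVf ?mul1r //.
by rewrite gt_eqF.
Qed.

Lemma sqrt_dot_gt0 x : x != 0 -> 0 < Num.sqrt (dot x x).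
Proof. by move=> /dotvv_gt0; rewrite sqrtr_gt0. Qed.

Lemma sdir_eq x y : x != 0 -> y != 0 -> sdir x = sdir y -> exists2 l, 0 < l & y = l *: x.
Proof.
move=> /sqrt_dot_gt0 x0 /sqrt_dot_gt0 y0; rewrite !sdirE => E.
exists (Num.sqrt (dot y y) / Num.sqrt (dot x x)); first by rewrite divr_gt0.
by rewrite -scalerA E scalerA divff ?scale1r // gt_eqF.
Qed.

Lemma sdir_opp x y : x != 0 -> y != 0 -> (exists2 l, 0 < l & y = - l *: x) -> sdir x = - sdir y.
Proof.
move=> x0 y0 [l l0 ->]; rewrite scaleNr -scalerN sdir_scale // !sdirE.
by rewrite !scalerN dotNr dotC dotNr opprK opprK.
Qed.

Lemma on_neq0 e x : cross e.1 e.2 != 0 -> on e x -> x != 0.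
Proof.
move=> c0 [t t01 Ex]; apply: contraNneq c0 => x0.
have [t0|t0] := eqVneq t 0.
  by move: Ex; rewrite x0 t0 subr0 scale1r scale0r addr0 => <-; rewrite cross0v.
have : t *: cross e.1 e.2 = cross e.1 x.
  by rewrite Ex crossDr !crossZr crossvv scaler0 add0r.
by move=> /eqP; rewrite x0 crossv0 scaler_eq0 (negPf t0).
Qed.

(** If [y = l *: x], the coefficients with respect to the independent vectors [a] and [b] are
    proportional by [l]; both pairs sum to 1, so [l = 1]. *)
Lemma sdir_inj_seg a b x y : cross a b != 0 -> seg a b x -> seg a b y ->
  sdir x = sdir y -> x = y.
Proof.
move=> c0 xs ys E.
have [l l0 Ey] := sdir_eq (@on_neq0 (a, b) _ c0 xs) (@on_neq0 (a, b) _ c0 ys) E.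
case: xs ys Ey => s s01 -> [t t01 ->] Ey.
have E1 := congr1 (cross a) Ey; have E2 := congr1 (cross b) Ey.
have {}E1 : (t - l * s) *: cross a b = 0.
  move/eqP: E1; rewrite -subr_eq0 => /eqP <-.
  by apply: ptP; rewrite /cross !coE; ring.
have {}E2 : ((1 - t) - l * (1 - s)) *: cross a b = 0.
  move/eqP: E2; rewrite -subr_eq0 => /eqP E2; rewrite -[LHS]opprK -oppr0 -E2; congr (- _).
  by apply: ptP; rewrite /cross !coE; ring.
move: E1 E2 => /eqP; rewrite scaler_eq0 (negPf c0) orbF => /eqP E1.
move=> /eqP; rewrite scaler_eq0 (negPf c0) orbF => /eqP E2.
have -> : s = t by (have : l = 1 by lra); nra.
by [].
Qed.

Lemma poly_nonroot (P : {poly R}) : P != 0 -> exists t, P.[t] != 0.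
Proof.
move=> P0; have [//|N] := pselect (exists t, P.[t] != 0).
(* As many distinct candidates as [size P], one more than the largest possible number of roots. *)
pose rs : seq R := [seq i%:R | i <- iota 0 (size P)].
have : (size rs < size P)%N.
  apply: max_poly_roots => //.
    by apply/allP => t _; rewrite rootE; apply: contrapT => /negP h; apply: N; exists t.
  rewrite map_inj_uniq ?iota_uniq // => i j /eqP; rewrite eqr_nat => /eqP; exact.
by rewrite size_map size_iota ltnn.
Qed.

Lemma finite_generic (T : eqType) (Z : seq T) (Good : T -> R -> Prop) :
  (forall z, z \in Z -> exists2 P : {poly R}, P != 0 & forall t, P.[t] != 0 -> Good z t) ->
  exists t, forall z, z \in Z -> Good z t.
Proof.
move=> H; suff [P P0 HP] : exists2 P : {poly R}, P != 0 &
    forall t, P.[t] != 0 -> forall z, z \in Z -> Good z t.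
  by have [t Pt] := poly_nonroot P0; exists t; apply: HP.
elim: Z H => [|z Z IH] H; first by exists 1; rewrite ?oner_neq0.
have [|P P0 HP] := IH; first by move=> y yZ; apply: H; rewrite inE yZ orbT.
have [|Q Q0 HQ] := H z; first by rewrite mem_head.
exists (P * Q); first by rewrite mulf_neq0.
move=> t; rewrite hornerM mulf_eq0 negb_or => /andP[Pt Qt] y.
by rewrite inE => /orP[/eqP->|]; [apply: HQ|apply: HP].
Qed.

(* A nonzero vector is orthogonal to u1 t, u2 t or cross (u1 t) (u2 t) for finitely
   many t only. *)
Definition u1 (t : R) : pt R := mkpt 1 t (t ^+ 2).
Definition u2 (t : R) : pt R := mkpt (- t) 1 (t ^+ 3).

Lemma poly_u1 x : x != 0 -> exists2 P : {poly R}, P != 0 & forall t, P.[t] = dot (u1 t) x.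
Proof.
move=> x0; pose P := (cx x)%:P + cy x *: 'X + cz x *: 'X^2 : {poly R}.
have PE t : P.[t] = dot (u1 t) x by rewrite /P /dot /u1 !(hornerD, hornerN, hornerZ, hornerXn, hornerX, hornerC) !coE; ring.
exists P => //; apply: contra_neq x0 => P0.
have := PE 0; have := PE 1; have := PE (-1); rewrite P0 !horner0 /dot /u1 !coE.
by move=> h1 h2 h3; apply: ptP; rewrite coE; lra.
Qed.

Lemma poly_u2 x : x != 0 -> exists2 P : {poly R}, P != 0 & forall t, P.[t] = dot (u2 t) x.
Proof.
move=> x0; pose P := (cy x)%:P - cx x *: 'X + cz x *: 'X^3 : {poly R}.
have PE t : P.[t] = dot (u2 t) x by rewrite /P /dot /u2 !(hornerD, hornerN, hornerZ, hornerXn, hornerX, hornerC) !coE; ring.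
exists P => //; apply: contra_neq x0 => P0.
have := PE 0; have := PE 1; have := PE 2; rewrite P0 !horner0 /dot /u2 !coE.
by move=> h1 h2 h3; apply: ptP; rewrite coE; lra.
Qed.

Lemma poly_u12 x : x != 0 ->
  exists2 P : {poly R}, P != 0 & forall t, P.[t] = dot x (cross (u1 t) (u2 t)).
Proof.
move=> x0; pose P := cx x *: ('X^4 - 'X^2) - (2 * cy x) *: 'X^3 + cz x *: (1 + 'X^2) : {poly R}.
have PE t : P.[t] = dot x (cross (u1 t) (u2 t)).
  by rewrite /P /dot /u2 !(hornerD, hornerN, hornerZ, hornerXn, hornerX, hornerC) !coE; ring.
exists P => //; apply: contra_neq x0 => P0.
have := PE 0; have := PE 1; have := PE 2; rewrite P0 !horner0 /dot /cross /u1 /u2 !coE.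
by move=> h1 h2 h3; apply: ptP; rewrite coE; lra.
Qed.

(** By regularity all common points of a non-adjacent pair lie in one direction, so a single point
    [x0] represents them and each pair of edges costs only one polynomial. *)
Lemma generic_direction p : regular (@sdir R) p ->
  (forall e, e \in edges p -> cross e.1 e.2 != 0) ->
  exists t, (forall e, e \in edges p -> dot (cross e.1 e.2) (cross (u1 t) (u2 t)) != 0) /\
    forall e f, e \in edges p -> f \in edges p -> nonadj e f -> forall x y, on e x -> on f y ->
      sdir x = sdir y -> dot (u1 t) x != 0 /\ dot (u2 t) x != 0.
Proof.
move=> [_ _ H3 _ _] C.
have [|t H] := @finite_generic _ [seq (e, f) | e <- edges p, f <- edges p] (fun ef t =>
    dot (cross ef.1.1 ef.1.2) (cross (u1 t) (u2 t)) != 0 /\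
    (nonadj ef.1 ef.2 -> forall x y, on ef.1 x -> on ef.2 y ->
      sdir x = sdir y -> dot (u1 t) x != 0 /\ dot (u2 t) x != 0)).
  move=> _ /allpairsP[[e f] /= [ep fp ->]] /=.
  have [P P0 HP] := poly_u12 (C e ep).
  have [[x0 [y0 [ex0 ey0 E0]]]|no] := pselect (exists x y, [/\ on e x, on f y & sdir x = sdir y]);
    last first.
    exists P => // t; rewrite HP => h; split=> // _ x y ex ey E.
    by case: no; exists x, y.
  have x00 := on_neq0 (C e ep) ex0.
  have [P1 P10 HP1] := poly_u1 x00; have [P2 P20 HP2] := poly_u2 x00.
  exists (P * (P1 * P2)); first by rewrite !mulf_neq0.
  move=> t; rewrite !hornerM HP HP1 HP2 !mulf_eq0 !negb_or => /and3P[h h1 h2].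
  split=> // nef x y ex ey E.
  have [l l0 ->] := sdir_eq x00 (on_neq0 (C e ep) ex) (H3 e f ep fp nef _ _ _ _ ex0 ey0 E0 ex ey E).
  by rewrite !dotZr !mulf_neq0 // gt_eqF.
exists t; split.
  by move=> e ep; have [] := H (e, e) (allpairs_f _ ep ep).
by move=> e f ep fp; have [_] := H (e, f) (allpairs_f _ ep fp).
Qed.

End Sphere.

(** * Subdividing where the linear forms vanish *)

Section Subdivision.
Variable R : realType.
Implicit Types (p q k : seq (pt R)) (e f g : pt R * pt R) (a b c x y m v u d : pt R).

(* Invariant of the subdivision process: N lists the normals of the planes of the
   great circle arcs and W the vertices at which two arcs are joined. *)
Definition subdivided k d (N W U : seq (pt R)) p := [/\ simple p /\ knot_equiv k p,
  regular (@sdir R) p,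
  (forall e, e \in edges p -> dot (cross e.1 e.2) d != 0 /\
     exists2 v, v \in N & dot v e.1 = 0 /\ dot v e.2 = 0),
  {subset W <= p} &
  (forall e f, e \in edges p -> f \in edges p -> nonadj e f -> forall x y, on e x -> on f y ->
     sdir x = sdir y -> forall u, u \in U -> dot u x != 0)].

Definition sign_change u e := dot u e.1 * dot u e.2 < 0.

Lemma subdivided_rot k d N W U n p :
  subdivided k d N W U p -> subdivided k d N W U (rot n p).
Proof.
case=> [[sp kp] rp C SW X]; split.
- by split; [apply: simple_rot | apply: kequiv_trans kp (kequiv_rot n sp)].
- exact: regular_rot.
- by move=> e; rewrite mem_edges_rot; apply: C.
- by move=> v vW; rewrite mem_rot SW.
- by move=> e f; rewrite !mem_edges_rot; apply: X.
Qed.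

Lemma count_rot (T : Type) (P : pred T) n (s : seq T) : count P (rot n s) = count P s.
Proof. by rewrite /rot count_cat addnC -count_cat cat_take_drop. Qed.

(** The new vertex is the zero of [u] on the edge. Crossings avoid the plane of [u], so it is not a
    crossing and the diagram stays regular. A form without a sign change on [a, b] has none on
    either half, so work done for another form is not undone. *)
Lemma subdivided_step k d N W U u a b l :
  subdivided k d N W U (a :: b :: l) -> u \in U -> sign_change u (a, b) ->
  exists m, [/\ subdivided k d N W U (a :: m :: b :: l), dot u m = 0 &
    forall u', ~~ sign_change u' (a, b) -> ~~ sign_change u' (a, m) /\ ~~ sign_change u' (m, b)].
Proof.
move=> [[sp kp] rp C SW X] uU; rewrite /sign_change /= => bd.
have bab : (a, b) \in edges (a :: b :: l) by rewrite edges_cons2 mem_head.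
have E m : edges (a :: m :: b :: l) = (a, m) :: (m, b) :: path_edges b l a by rewrite edges_cons2 path_edges_cons.
pose s := dot u a / (dot u a - dot u b).
have ne0 : dot u a - dot u b != 0 by apply/eqP => h; nra.
have s01 : 0 < s < 1.
  have [ha|ha] := ltP (dot u a) 0.
    rewrite /s -(opprK (dot u a)) -[X in _ / X]opprK invrN mulrNN.
    rewrite divr_gt0 ?ltr_pdivrMr //; nra.
  rewrite /s divr_gt0 ?ltr_pdivrMr //; nra.
pose m := (1 - s) *: a + s *: b; have Em : m = (1 - s) *: a + s *: b by [].
have um : dot u m = 0.
  by rewrite /m dotDr !dotZr /s; field.
have [/= dab [v vN [va vb]]] := C _ bab.
have c0 : cross a b != 0 by apply: contraNneq dab => ->; rewrite dot0l.
have inj x y : seg a b x -> seg a b y -> sdir x = sdir y -> x = y by apply: sdir_inj_seg.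
have mab : seg a b m by exists s; [lra|].
have [_ H2 _ _ _] := rp.
have [_ um' corner _] := simple_subdivide s01 Em sp.
have /and3P[am bm ml] : [&& a != m, b != m & m \notin l].
  move: um'; rewrite /= !inE !negb_or => /and3P[/and3P[-> _ _] /andP[mb ->] _].
  by rewrite eq_sym mb.
have nm e : e \in path_edges b l a -> forall y, on e y -> sdir m <> sdir y.
  move=> ep y ey Emy; have ee := path_edges_subset ep.
  have [Eb|nb] := eqVneq e.1 b.
    move/eqP: bm; apply; apply/esym/inj => //; first exact: seg_r.
    by rewrite -Eb; apply: (H2 (a, b) e bab ee _ m y).
  have [Ea|na] := eqVneq e.2 a.
    move/eqP: am; apply; apply/esym/inj => //; first exact: seg_l.
    by rewrite Emy; apply: (H2 e (a, b) ee bab _ y m).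
  have : nonadj (a, b) e.
    rewrite /nonadj /= na eq_sym [b == _]eq_sym nb !andbT.
    by apply: contraTneq (path_edges1 ep) => ->; case: sp => _ /andP[].
  by move=> n1; have := X _ _ bab ee n1 m y mab ey Emy u uU; rewrite um eqxx.
exists m; split=> //; last first.
  move=> u'; rewrite -!leNgt /= /m dotDr !dotZr => h.
  have h1 := sqr_ge0 (dot u' a); have h2 := sqr_ge0 (dot u' b); rewrite !expr2 in h1 h2.
  have E1 : dot u' a * ((1 - s) * dot u' a + s * dot u' b) =
     (1 - s) * (dot u' a * dot u' a) + s * (dot u' a * dot u' b) by ring.
  have E2 : ((1 - s) * dot u' a + s * dot u' b) * dot u' b =
     (1 - s) * (dot u' a * dot u' b) + s * (dot u' b * dot u' b) by ring.
  by rewrite E1 E2; split; rewrite addr_ge0 // mulr_ge0 //; lra.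
have [par [P1 P2 P3]] := nonadj_subdivide s01 Em sp rp inj.
split.
- split; first exact: simple_subdivide s01 Em sp.
  exact: kequiv_trans kp (kequiv_subdivide s01 Em sp).
- exact: regular_subdivide s01 Em sp rp inj nm.
- move=> e; rewrite E !inE => /or3P[/eqP->|/eqP->|/path_edges_subset/C//] /=; split.
  + rewrite Em crossDr !crossZr crossvv scaler0 add0r dotC dotZr dotC.
    by rewrite mulf_neq0 // gt_eqF; lra.
  + by exists v => //; rewrite Em dotDr !dotZr va vb !mulr0 addr0.
  + rewrite Em crossDl !crossZl crossvv scaler0 addr0 dotC dotZr dotC.
    by rewrite mulf_neq0 // gt_eqF; lra.
  + by exists v => //; rewrite Em dotDr !dotZr va vb !mulr0 addr0.
- by move=> w /SW; rewrite !inE => /or3P[|->|->]; rewrite ?orbT // => ->.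
- move=> e f ep fp nef x y ex ey Exy.
  have pes g : g \in edges (a :: m :: b :: l) -> par g \in edges (a :: b :: l).
    by move=> /P1[[-> _] //|[-> /path_edges_subset]].
  exact: (X _ _ (pes _ ep) (pes _ fp) (P3 _ _ ep fp nef _ _ ex ey Exy) x y (P2 _ ep _ ex) (P2 _ fp _ ey) Exy).
Qed.

(** Induction on the number of sign changes: on both halves the product of the end values is 0,
    which the strict [sign_change] does not count. *)
Lemma subdivided_good k d N W U u p : subdivided k d N W U p -> u \in U ->
  exists q, [/\ subdivided k d N W U q, ~~ has (sign_change u) (edges q) &
    forall u', ~~ has (sign_change u') (edges p) -> ~~ has (sign_change u') (edges q)].
Proof.
move=> + uU; have [n] := ubnP (count (sign_change u) (edges p)); elim: n p => // n IH p cn ip.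
have [|no] := boolP (has (sign_change u) (edges p)); last by exists p.
move=> /hasP[e ep be]; have [i s' Es] := rot_to ep.
have := subdivided_rot i ip; have {}Es : edges (rot i p) = e :: s' by rewrite edges_rot.
have cr u' : count (sign_change u') (edges (rot i p)) = count (sign_change u') (edges p) by rewrite edges_rot count_rot.
move: Es cr; case: (rot i p) => [|a [|b l]] // Es cr ip'.
  by have [[[]]] := ip'.
have Ee : (a, b) = e by move: Es; rewrite edges_cons2 => -[].
rewrite -Ee in be; have [m [im um gm]] := subdivided_step ip' uU be.
have E2 : edges (a :: m :: b :: l) = (a, m) :: (m, b) :: path_edges b l a by rewrite edges_cons2 path_edges_cons.
have [|q [iq bq gq]] := IH (a :: m :: b :: l) _ im.
  rewrite -ltnS; apply: leq_trans _ cn; rewrite ltnS -cr E2 edges_cons2 /= be.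
  by rewrite {1 2}/sign_change /= um mul0r mulr0 ltxx.
exists q; split=> // u' gu'; apply: gq.
move: gu'; rewrite !has_count -!eqn0Ngt -cr E2 edges_cons2 /= addn_eq0 eqb0 => /andP[/gm[g1 g2] /eqP->].
by rewrite (negPf g1) (negPf g2).
Qed.

End Subdivision.

(** * The shear into a half-space *)

Section Shear.
Variables (R : realType) (u1 u2 : pt R).
Implicit Types (p q k : seq (pt R)) (e f g : pt R * pt R) (a b c x y m v u : pt R) (s t K l : R).
Let d := cross u1 u2.

(** A piecewise linear gauge of the distance from the line of [d]: both forms vanish on [d], so the
    shear leaves the gauge fixed and can be undone. *)
Definition height x := `|dot u1 x| + `|dot u2 x|.
Definition shear K t x := x + (t * (K * height x)) *: d.

Lemma height_ge0 x : 0 <= height x.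
Proof. by rewrite addr_ge0. Qed.

Lemma height_scale l x : 0 < l -> height (l *: x) = l * height x.
Proof. by move=> l0; rewrite /height !dotZr !normrM gtr0_norm // mulrDr. Qed.

(** An absolute value is linear where its argument keeps its sign; if the end values have a
    nonnegative product and yet differ in sign, one of them is 0. *)
Lemma height_seg a b s : 0 <= s <= 1 -> ~~ sign_change u1 (a, b) -> ~~ sign_change u2 (a, b) ->
  height ((1 - s) *: a + s *: b) = (1 - s) * height a + s * height b.
Proof.
move=> s01; have s01' : 0 <= 1 - s by lra.
have s0 : 0 <= s by lra.
have key u : ~~ sign_change u (a, b) ->
    `|dot u ((1 - s) *: a + s *: b)| = (1 - s) * `|dot u a| + s * `|dot u b|.
  rewrite /sign_change /= -leNgt dotDr !dotZr => h.
  have [ha|ha] := leP 0 (dot u a); have [hb|hb] := leP 0 (dot u b).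
  - by rewrite !ger0_norm // addr_ge0 ?mulr_ge0.
  - have -> : dot u a = 0.
      by apply/eqP; rewrite eq_le ha andbT leNgt; apply: contraL h => h'; rewrite -ltNge pmulr_rlt0.
    by rewrite normr0 !mulr0 !add0r normrM ger0_norm.
  - have -> : dot u b = 0.
      by apply/eqP; rewrite eq_le hb andbT leNgt; apply: contraL h => h'; rewrite -ltNge pmulr_llt0.
    by rewrite normr0 !mulr0 !addr0 normrM ger0_norm.
  - have h1 : (1 - s) * dot u a <= 0 by rewrite mulr_ge0_le0 // ltW.
    have h2 : s * dot u b <= 0 by rewrite mulr_ge0_le0 // ltW.
    by rewrite !ler0_norm ?(ltW ha) ?(ltW hb) //; lra.
by move=> n1 n2; rewrite /height !key //; lra.
Qed.

Lemma dot_u1_shear K t x : dot u1 (shear K t x) = dot u1 x.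
Proof. by rewrite /shear dotDr dotZr [dot u1 d]dotC dot_crossl mulr0 addr0. Qed.
Lemma dot_u2_shear K t x : dot u2 (shear K t x) = dot u2 x.
Proof. by rewrite /shear dotDr dotZr [dot u2 d]dotC dot_crossr mulr0 addr0. Qed.

Lemma shear_inj K t x y : shear K t x = shear K t y -> x = y.
Proof.
move=> E; have h : height x = height y.
  have h1 : dot u1 x = dot u1 y by rewrite -(dot_u1_shear K t x) E dot_u1_shear.
  have h2 : dot u2 x = dot u2 y by rewrite -(dot_u2_shear K t x) E dot_u2_shear.
  by rewrite /height h1 h2.
by move: E; rewrite /shear h => /addIr.
Qed.

Lemma shear0 K x : shear K 0 x = x.
Proof. by rewrite /shear mul0r scale0r addr0. Qed.

Lemma shear_scale K t l x : 0 < l -> shear K t (l *: x) = l *: shear K t x.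
Proof.
move=> l0; rewrite /shear height_scale // scalerDr scalerA; congr (_ + _ *: _); ring.
Qed.

Lemma shear_seg K t a b s : 0 <= s <= 1 -> ~~ sign_change u1 (a, b) -> ~~ sign_change u2 (a, b) ->
  shear K t ((1 - s) *: a + s *: b) = (1 - s) *: shear K t a + s *: shear K t b.
Proof.
by move=> s01 n1 n2; rewrite /shear height_seg //; apply: ptP; rewrite !coE; ring.
Qed.

Lemma shear_cover K t e : ~~ sign_change u1 e -> ~~ sign_change u2 e -> seg_cover (shear K t) e.
Proof.
case: e => a b n1 n2 _ [s s01 ->]; exists ((1 - s) *: a + s *: b); first by exists s.
by rewrite shear_seg.
Qed.

Lemma shear_lip K v s t :
  nrm (shear K s v - shear K t v) <= nrm ((K * height v) *: d) * `|s - t|.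
Proof.
rewrite mulrC -nrmZ scalerA /shear (_ : _ - _ = ((s - t) * (K * height v)) *: d) //.
by apply: ptP; rewrite !coE; ring.
Qed.

(** If both forms vanished at [e.1], this vector would be parallel to [d], and [d] would lie in the
    plane of the edge. *)
Lemma height_gt0 e : dot (cross e.1 e.2) d != 0 -> 0 < height e.1.
Proof.
move=> n0; rewrite lt0r height_ge0 andbT; apply: contra_neqN n0.
rewrite /height paddr_eq0 // !normr_eq0 => /andP[/eqP h1 /eqP h2].
have [->|d0] := eqVneq d 0; first by rewrite dot0r.
have : cross d e.1 = 0.
  rewrite crossC crossA dotC h2 dotC h1 !scale0r subr0 oppr0 //.
move/(cross_eq0 d0) => ->; rewrite dot_cross_rot [dot _ (_ *: _)]dotC.
by rewrite dotC dotZr dot_crossr mulr0.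
Qed.

Lemma shear_above p : 0 < cz d -> (forall v, v \in p -> 0 < height v) ->
  exists K, forall v, v \in p -> 0 < cz (shear K 1 v).
Proof.
move=> d0 hp; have [||h h0 H] := @all_small R _ p (fun h v => h * `|cz v| < height v * cz d).
- by move=> h h' v hh; apply: le_lt_trans; rewrite ler_wpM2r.
- move=> v vp; have n0 := normr_ge0 (cz v).
  have hv : 0 < height v * cz d by rewrite mulr_gt0 // hp.
  exists (height v * cz d / (`|cz v| + 1)); first by rewrite divr_gt0 //; lra.
  rewrite mulrAC ltr_pdivrMr; last lra.
  by rewrite mulrDr mulr1 ltrDl.
exists h^-1 => v vp; rewrite /shear czD czZ mul1r -mulrA.
have : `|cz v| < h^-1 * (height v * cz d) by rewrite mulrC ltr_pdivlMr // mulrC H.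
have := ler_norm (- cz v); rewrite normrN; lra.
Qed.

End Shear.

(** * The projective isotopy of a half-space *)

Section Projective.
Variable R : realType.
Implicit Types (p q k : seq (pt R)) (e f g : pt R * pt R) (a b c x y m v u : pt R) (s t K l : R).

(* The orientation preserving projective isotopy of the half-space z > 0 from the
   identity to (x, y, z) |-> (x/z, y/z, -1/z). *)
Definition pden t x := (1 - t) + t * cz x.
Definition projmap t x := (pden t x)^-1 *: mkpt (cx x) (cy x) ((1 - t) * cz x - t).

Lemma pden_gt0 t x : 0 <= t <= 1 -> 0 < cz x -> 0 < pden t x.
Proof.
move=> t01 z0; rewrite /pden; have [->|tn] := eqVneq t 0; first by rewrite subr0 mul0r addr0.
have : 0 < t by rewrite lt0r tn; lra.
nra.
Qed.

Lemma projmap0 x : projmap 0 x = x.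
Proof. by apply: ptP; rewrite /projmap /pden !coE; field. Qed.

(** On third coordinates the map is a Moebius transformation of determinant [(1 - t) ^+ 2 + t ^+ 2],
    which is positive. Equal third coordinates give equal denominators, and the other coordinates
    follow. *)
Lemma projmap_inj t x y : 0 <= t <= 1 -> 0 < cz x -> 0 < cz y -> projmap t x = projmap t y -> x = y.
Proof.
move=> t01 x0 y0 E; have wx := pden_gt0 t01 x0; have wy := pden_gt0 t01 y0.
have Ez : cz x = cz y.
  have := congr1 cz E; rewrite !coE => /(congr1 (fun r => pden t x * (pden t y * r))).
  rewrite mulrCA mulVKf ?gt_eqF // mulVKf ?gt_eqF // /pden => h.
  have : ((1 - t) ^+ 2 + t ^+ 2) * (cz x - cz y) = 0 by rewrite !expr2; lra.
  move/eqP; rewrite mulf_eq0 subr_eq0 => /orP[/eqP h0|/eqP //].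
  have := sqr_ge0 (1 - t); have := sqr_ge0 t; rewrite !expr2 in h0 *; nra.
have Ew : pden t x = pden t y by rewrite /pden Ez.
move: E; rewrite /projmap Ew => /scalerI; rewrite invr_eq0 gt_eqF // => /(_ isT) E.
by apply: ptP => //; have := congr1 (@cx R) E; have := congr1 (@cy R) E; rewrite !coE.
Qed.

Lemma projmap_cover t e : 0 <= t <= 1 -> 0 < cz e.1 -> 0 < cz e.2 -> seg_cover (projmap t) e.
Proof.
case: e => a b t01 /= a0 b0 _ [s s01 ->].
have wa := pden_gt0 t01 a0; have wb := pden_gt0 t01 b0.
have D0 : 0 < (1 - s) * pden t b + s * pden t a.
  have [->|sn] := eqVneq s 0; first by rewrite subr0 mul1r mul0r addr0.
  have : 0 < s by rewrite lt0r sn; lra.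
  nra.
(* The weights [1 - s] and [s] belong to points already divided by their denominators; in
   homogeneous coordinates each gets multiplied by the denominator of the other end. *)
pose r := s * pden t a / ((1 - s) * pden t b + s * pden t a).
have r01 : 0 <= r <= 1.
  rewrite /r divr_ge0 ?ler_pdivrMr ?mulr_ge0 ?(ltW wa) ?(ltW D0) //=; [|lra].
  rewrite mul1r lerDr mulr_ge0 ?(ltW wb) //; lra.
exists ((1 - r) *: a + r *: b); first by exists r.
have E1 : 1 - r = (1 - s) * pden t b / ((1 - s) * pden t b + s * pden t a).
  by rewrite /r; field; rewrite gt_eqF.
have Ew : pden t ((1 - r) *: a + r *: b) =
    pden t a * pden t b / ((1 - s) * pden t b + s * pden t a).
  have -> : pden t ((1 - r) *: a + r *: b) = (1 - r) * pden t a + r * pden t b.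
    by rewrite /pden !coE; ring.
  by rewrite E1 /r; field; rewrite gt_eqF.
have wan : pden t a != 0 by rewrite gt_eqF.
have wbn : pden t b != 0 by rewrite gt_eqF.
have Dn : (1 - s) * pden t b + s * pden t a != 0 by rewrite gt_eqF.
rewrite /projmap Ew E1 /r; move: (pden t a) (pden t b) wan wbn Dn => A B An Bn Dn.
by apply: ptP; rewrite !coE; field; rewrite An Bn Dn.
Qed.

(** The denominator is a convex combination of 1 and [cz v], hence at least [M], and the difference
    of two stages has the numerator [s - t] times a fixed vector [C]. *)
Lemma projmap_lip v : 0 < cz v -> exists L, forall s t, 0 <= s <= 1 -> 0 <= t <= 1 ->
  nrm (projmap s v - projmap t v) <= L * `|s - t|.
Proof.
move=> z0; pose M := Num.min 1 (cz v).
have M0 : 0 < M by rewrite lt_min z0 ltr01.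
pose C := mkpt (cx v * (1 - cz v)) (cy v * (1 - cz v)) (- (cz v ^+ 2 + 1)).
exists ((M ^- 2) * nrm C) => s t s01 t01.
have ws := pden_gt0 s01 z0; have wt := pden_gt0 t01 z0.
have E : projmap s v - projmap t v = ((s - t) / (pden s v * pden t v)) *: C.
  apply: ptP; rewrite /projmap /C !coE.
  - have h : pden t v - pden s v = (s - t) * (1 - cz v) by rewrite /pden; ring.
    transitivity (cx v * (pden t v - pden s v) / (pden s v * pden t v)); last by rewrite h; ring.
    by field; rewrite !gt_eqF.
  - have h : pden t v - pden s v = (s - t) * (1 - cz v) by rewrite /pden; ring.
    transitivity (cy v * (pden t v - pden s v) / (pden s v * pden t v)); last by rewrite h; ring.
    by field; rewrite !gt_eqF.
  - have h : ((1 - s) * cz v - s) * pden t v - ((1 - t) * cz v - t) * pden s v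
        = - (s - t) * (cz v ^+ 2 + 1) by rewrite /pden; ring.
    transitivity ((((1 - s) * cz v - s) * pden t v - ((1 - t) * cz v - t) * pden s v)
        / (pden s v * pden t v)); last by rewrite h; ring.
    by field; rewrite !gt_eqF.
have lb r : 0 <= r <= 1 -> M <= pden r v.
  move=> r01; have m1 : M <= 1 by rewrite ge_min lexx.
  have mz : M <= cz v by rewrite ge_min lexx orbT.
  rewrite /pden; nra.
have h : (pden s v * pden t v)^-1 <= M ^- 2.
  rewrite lef_pV2 ?posrE ?mulr_gt0 ?exprn_gt0 // expr2.
  by rewrite ler_pM ?(ltW M0) ?lb.
rewrite E nrmZ normrM normfV (gtr0_norm (mulr_gt0 ws wt)).
rewrite [X in _ <= X](_ : _ = `|s - t| * M ^- 2 * nrm C); last by rewrite mulrC mulrA.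
by rewrite ler_wpM2r ?nrm_ge0 // ler_wpM2l.
Qed.

(** At time 1 the first two coordinates are those of the central projection onto the plane z = 1,
    whose fibres are rays. *)
Lemma proj_projmap1 x y : 0 < cz x -> 0 < cz y ->
  proj_xy (projmap 1 x) = proj_xy (projmap 1 y) <-> y = (cz y / cz x) *: x.
Proof.
move=> x0 y0.
have P z : proj_xy z = mkpt (cx z) (cy z) 0.
  by apply: ptP; rewrite ?coE /proj_xy ?{1}/cx ?{1}/cy ?{1}/cz mxE //=; congr (z _ _); apply: val_inj.
rewrite !P /projmap /pden !subrr !add0r !mul1r; split=> E.
  have h1 := congr1 (@cx R) E; have h2 := congr1 (@cy R) E; rewrite !coE in h1 h2.
  have xn : cz x != 0 by rewrite gt_eqF.
  have yn : cz y != 0 by rewrite gt_eqF.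
  apply: ptP; rewrite !coE.
  - by rewrite -mulrA h1 mulVKf.
  - by rewrite -mulrA h2 mulVKf.
  - by rewrite divfK.
rewrite E !coE; congr (mkpt _ _ _); field; by rewrite !gt_eqF.
Qed.

End Projective.

(** * From the spherical to the planar diagram *)

Section Planar.
Variable R : realType.
Implicit Types (p q k : seq (pt R)) (e f g : pt R * pt R) (a b c x y m v u d : pt R) (s t K l : R).

Lemma spherical_to_planar k N W u1 u2 q :
  subdivided k (cross u1 u2) N W [:: u1; u2] q ->
  ~~ has (sign_change u1) (edges q) -> ~~ has (sign_change u2) (edges q) -> 0 < cz (cross u1 u2) ->
  exists F, [/\ knot_equiv q (map F q), simple (map F q), regular (@proj_xy R) (map F q),
    forall e f, e \in edges q -> f \in edges q -> forall x y, on e x -> on f y ->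
      proj_xy (F x) = proj_xy (F y) -> sdir x = sdir y
    & forall e, e \in edges q -> seg_cover F e].
Proof.
move=> [[sq kq] rq C _ _] /hasPn n1 /hasPn n2 d0.
have hq v : v \in q -> 0 < height u1 u2 v.
  case/memP_vtx=> i hi ->; have ei := mem_edge hi.
  by have := height_gt0 (proj1 (C _ ei)).
have [K HK] := shear_above d0 hq.
pose S := shear u1 u2 K; pose q1 := map (S 1) q.
have Scov t e : e \in edges q -> seg_cover (S t) e.
  by move=> ep; exact: shear_cover (n1 e ep) (n2 e ep).
have simS t : simple (map (S t) q).
  by apply: simple_map => // [e f _ _ x y _ _|e ep]; [apply: shear_inj|apply: Scov].
have Szpos e x : e \in edges q -> on e x -> 0 < cz (S 1 x).
  move=> ep [s s01 ->]; rewrite /S shear_seg //; last 2 first.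
  - by case: e ep => a b; apply: n1.
  - by case: e ep => a b; apply: n2.
  rewrite czD !czZ; have := HK _ (edges_mem1 ep); have := HK _ (edges_mem2 ep).
  set A := cz _; set B := cz _ => A0 B0.
  have [->|s0] := eqVneq s 0; first by rewrite subr0 mul1r mul0r addr0.
  have : 0 < s by rewrite lt0r s0; lra.
  nra.
have k1 : knot_equiv q q1.
  have E0 : map (S 0) q = q by rewrite map_id_in // => v _; apply: shear0.
  have [_ uq _ _] := sq; rewrite -{1}E0 /q1.
  apply: (kequiv_isotopy uq) => //.
  move=> v _ s t _ _; exact: shear_lip.
have s1 : simple q1 by apply: simS.
have z1 e x : e \in edges q1 -> on e x -> 0 < cz x.
  by rewrite edges_map => /mapP[f fp ->] /(Scov 1 f fp)[y fy ->]; apply: Szpos fy.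
have z1v v : v \in q1 -> 0 < cz v by case/mapP=> w wq ->; apply: HK.
have Pcov t e : 0 <= t <= 1 -> e \in edges q1 -> seg_cover (projmap t) e.
  move=> t01 ep; apply: projmap_cover => //; apply: z1v; [exact: edges_mem1|exact: edges_mem2].
have k2 : knot_equiv q1 (map (projmap 1) q1).
  have E0 : map (projmap 0) q1 = q1 by rewrite map_id_in // => v _; apply: projmap0.
  have [_ uq _ _] := s1.
  have HL v : exists L : R, v \in q1 -> forall s t, 0 <= s <= 1 -> 0 <= t <= 1 ->
      nrm (projmap s v - projmap t v) <= L * `|s - t|.
    have [vq|_] := boolP (v \in q1); last by exists 0.
    by have [L HL] := projmap_lip (z1v _ vq); exists L.
  have [L {}HL] := choice HL.
  rewrite -{1}E0; apply: (kequiv_isotopy (L := L) uq) => // t t01.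
  apply: simple_map => // [e f ep fp x y ex fy|e]; last exact: Pcov.
  by apply: projmap_inj => //; [apply: z1 ex|apply: z1 fy].
have one01 : 0 <= (1 : R) <= 1 by rewrite ler01 lexx.
exists (projmap 1 \o S 1); rewrite map_comp -/q1.
have cov e : e \in edges q -> seg_cover (projmap 1 \o S 1) e.
  move=> ep y ys; have ep1 : (S 1 e.1, S 1 e.2) \in edges q1.
    by rewrite /q1 edges_map; apply/mapP; exists e.
  have [z zs ->] := Pcov 1 _ one01 ep1 y ys.
  by have [x xe ->] := Scov 1 e ep z zs; exists x.
(* The heart of the transfer: the shear commutes with positive scaling and is injective, so points
   of one ray go to points of one ray and conversely. *)
have ker e f : e \in edges q -> f \in edges q -> forall x y, on e x -> on f y ->
    proj_xy ((projmap 1 \o S 1) x) = proj_xy ((projmap 1 \o S 1) y) <-> sdir x = sdir y.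
  move=> ep fp x y ex fy /=; have x0 := Szpos _ _ ep ex; have y0 := Szpos _ _ fp fy.
  have ne e' x' : e' \in edges q -> on e' x' -> x' != 0.
    move=> ep' /on_neq0; apply; have [+ _] := C _ ep'.
    by apply: contra_neq => ->; rewrite dot0l.
  rewrite proj_projmap1 //; split.
    have l0 : 0 < cz (S 1 y) / cz (S 1 x) by rewrite divr_gt0.
    by rewrite -[_ *: S 1 x]shear_scale // => /shear_inj ->; rewrite sdir_scale.
  move=> /(sdir_eq (ne _ _ ep ex) (ne _ _ fp fy))[l l0 ->].
  rewrite /S shear_scale // czZ mulfK // gt_eqF //.
split=> //.
- exact: kequiv_trans k1 k2.
- by have /(kequiv_simple k2) := s1.
- by rewrite /q1 -map_comp; apply: (regular_map rq) => // e f ep fp x y ex fy; apply: ker ex fy.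
- by move=> e f ep fp x y ex fy /(ker e f ep fp x y ex fy).
Qed.

End Planar.

(** * Counting crossings by ordered pairs of arcs *)

Section Counting.
Variable R : realType.
Implicit Types (p q k : seq (pt R)) (e f g : pt R * pt R) (a b c x y m v u d : pt R) (s t K l : R).

Lemma dot_on v e x : dot v e.1 = 0 -> dot v e.2 = 0 -> on e x -> dot v x = 0.
Proof. by move=> h1 h2 [t _ ->]; rewrite dotDr !dotZr h1 h2 !mulr0 addr0. Qed.

(** Both vectors lie on the line of [cross a b], and the sign selects the half-line. For [y] the
    weak inequality suffices because [y] is nonzero; a junction provides no more. *)
Lemma perp2_sdir a b x y : dot a x = 0 -> dot b x = 0 -> dot a y = 0 -> dot b y = 0 ->
  y != 0 -> 0 < dot x (cross a b) -> 0 <= dot y (cross a b) -> sdir x = sdir y.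
Proof.
move=> ax bx ay by_ y0 hx hy; set n := cross a b in hx hy.
have n0 : n != 0 by apply: contraTneq hx => ->; rewrite dot0r ltxx.
have par z : dot a z = 0 -> dot b z = 0 -> z = (dot n z / dot n n) *: n.
  move=> az bz; apply: cross_eq0 => //; rewrite crossC crossA dotC bz dotC az.
  by rewrite !scale0r subr0 oppr0.
have nn := dotvv_gt0 n0.
have Ex := par x ax bx; have Ey := par y ay by_.
have cx0 : 0 < dot n x / dot n n by rewrite divr_gt0 // dotC.
have cy0 : 0 < dot n y / dot n n.
  rewrite lt0r divr_ge0 ?(dotC n y) ?(ltW nn) // andbT.
  by apply: contra_neq y0 => h; rewrite Ey (dotC n y) h scale0r.
by rewrite Ex Ey !sdir_scale.
Qed.

(* Two arcs of one great circle meeting at an interior point would overlap. *)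
Lemma crossing_transverse q e f na nb x y :
  regular (@sdir R) q -> e \in edges q -> f \in edges q -> nonadj e f ->
  cross e.1 e.2 != 0 -> cross f.1 f.2 != 0 -> na != 0 ->
  dot na e.1 = 0 -> dot na e.2 = 0 -> dot nb f.1 = 0 -> dot nb f.2 = 0 -> nb != 0 ->
  on e x -> on f y -> sdir x = sdir y -> cross na nb != 0.
Proof.
case: e f => a b [c d] /= [H1 H2 H3 H4 H5] ep fp nef cab ccd na0 naa nab nbc nbd nb0 ex fy Exy.
apply/eqP => nab0.
have [nac nad] : dot na c = 0 /\ dot na d = 0.
  have nba : cross nb na = 0 by rewrite crossC nab0 oppr0.
  by rewrite (cross_eq0 nb0 nba) !dotZl nbc nbd !mulr0.
have x0 := @on_neq0 _ (a, b) _ cab ex; have y0 := @on_neq0 _ (c, d) _ ccd fy.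
have [l l0 Ey] := sdir_eq x0 y0 Exy.
have nv := H4 _ _ ep fp nef x y ex fy Exy.
have ab : b - a != 0.
  by rewrite subr_eq0; apply: contraNneq cab => ->; rewrite crossvv.
have : dot (cross c d) (b - a) = 0.
  have -> : cross c d = (dot na (cross c d) / dot na na) *: na.
    by apply: cross_eq0 => //; rewrite crossA nad nac !scale0r subrr.
  by rewrite dotZl dotDr dotNr naa nab subrr mulr0.
move=> /(plane_basis ccd)[al [be Eba]].
have [s s01 Ex] := ex; have [r r01 Ey'] := fy; rewrite /= in Ex Ey'.
have s1 : s != 1.
  apply/eqP => s1; apply: (nv b); first by apply: (edges_mem2 ep).
  by rewrite Ex s1 subrr scale0r scale1r add0r.
have r1 : r != 1.
  apply/eqP => r1; apply: (nv d); first by apply: (edges_mem2 fp).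
  by rewrite Exy Ey' r1 subrr scale0r scale1r add0r.
have r0 : r != 0.
  apply/eqP => r0; apply: (nv c); first by apply: (edges_mem1 fp).
  by rewrite Exy Ey' r0 subr0 scale0r scale1r addr0.
have s1' : 0 < 1 - s by rewrite lt0r subr_eq0 eq_sym s1; lra.
have r1' : 0 < 1 - r by rewrite lt0r subr_eq0 eq_sym r1; lra.
have r0' : 0 < r by rewrite lt0r r0; lra.
(* A step [ep0] along [a, b] stays on that edge, and the ray through the new point still meets
   [c, d]: [P] and [Q] are its coefficients at [c] and [d], positive for a small step. This second
   crossing contradicts regularity. *)
have [ep0 [E0 E1 E2 E3]] : exists h, [/\ 0 < h, h <= 1 - s, 0 < 1 - r + l * h * al
    & 0 < r + l * h * be].
  have al0 := normr_ge0 al; have be0 := normr_ge0 be.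
  pose A := (1 - r) / (l * `|al| + 1); pose B := r / (l * `|be| + 1).
  have la0 : 0 <= l * `|al| by rewrite mulr_ge0 // ltW.
  have lb0 : 0 <= l * `|be| by rewrite mulr_ge0 // ltW.
  have A0 : 0 < A by rewrite /A divr_gt0 //; lra.
  have B0 : 0 < B by rewrite /B divr_gt0 //; lra.
  exists (Num.min (1 - s) (Num.min A B)); set h := Num.min _ _.
  have h0 : 0 < h by rewrite /h !lt_min s1' A0 B0.
  have hs : h <= 1 - s by rewrite /h ge_min lexx.
  have hA : h * (l * `|al| + 1) <= 1 - r.
    by rewrite -ler_pdivlMr; [rewrite /h !ge_min lexx !orbT|lra].
  have hB : h * (l * `|be| + 1) <= r.
    by rewrite -ler_pdivlMr; [rewrite /h !ge_min lexx !orbT|lra].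
  have low z : - (h * (l * `|z|)) <= l * h * z.
    have := lerNnormlW (lexx `|z|) => hz.
    have zz : 0 <= z + `|z| by lra.
    have : 0 <= l * h * (z + `|z|) by rewrite mulr_ge0 // mulr_ge0 // ltW.
    lra.
  by split=> //; [have := low al|have := low be]; lra.
pose P := 1 - r + l * ep0 * al; pose Q := r + l * ep0 * be.
have PQ : 0 < P + Q by rewrite addr_gt0.
pose x' := x + ep0 *: (b - a); pose y' := (P + Q)^-1 *: (l *: x').
have ex' : on (a, b) x'.
  exists (s + ep0); first lra.
  by rewrite /x' Ex; apply: ptP; rewrite !coE /=; ring.
have fy' : on (c, d) y'.
  exists (Q / (P + Q)).
    by rewrite divr_ge0 ?ler_pdivrMr ?mul1r ?lerDr ?(ltW PQ) ?(ltW E2) ?(ltW E3).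
  have PQn : P + Q != 0 by rewrite gt_eqF.
  have EP : (P + Q) * (1 - Q / (P + Q)) = P by rewrite mulrBr mulr1 mulrC divfK // addrK.
  have EQ : (P + Q) * (Q / (P + Q)) = Q by rewrite mulrC divfK.
  apply: (scalerI PQn); rewrite /= scalerDr !scalerA EP EQ mulfV // mul1r.
  rewrite /x' scalerDr -Ey Ey' Eba /P /Q.
  by apply: ptP; rewrite !coE /=; ring.
have Exy' : sdir x' = sdir y' by rewrite /y' !sdir_scale // invr_gt0.
have := H3 _ _ ep fp nef x y x' y' ex fy Exy ex' fy' Exy'.
move/(sdir_inj_seg cab ex ex')/eqP.
rewrite /x' eq_sym addrC -subr_eq0 addrK scaler_eq0 (negPf ab) orbF gt_eqF //.
Qed.

(** Here [w i] is the junction at the end of arc [i]. Codes of crossings avoid the set [X] of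
    diagonal and junction pairs, which has [n + n] elements. *)
Lemma crossing_bound n (N w : 'I_n -> pt R) q (s : seq (nat * nat)) : (1 < n)%N ->
  simple q -> regular (@sdir R) q ->
  (forall e, e \in edges q -> cross e.1 e.2 != 0 /\ exists i, dot (N i) e.1 = 0 /\ dot (N i) e.2 = 0) ->
  (forall i, N i != 0) -> (forall i, w i \in q) -> injective w ->
  (forall i, dot (N i) (w i) = 0 /\ dot (N (ordS i)) (w i) = 0) ->
  uniq s ->
  (forall i j, (i, j) \in s -> [/\ (i < j)%N, (j < size q)%N,
     nonadj (vtx q i, vtx q i.+1) (vtx q j, vtx q j.+1) &
     exists x y, [/\ seg (vtx q i) (vtx q i.+1) x, seg (vtx q j) (vtx q j.+1) y & sdir x = sdir y]]) ->
  (size s + (n + n) <= n * n)%N.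
Proof.
move=> n1 sq rq C N0 wq wi wN us Hs; have [_ uq _ _] := sq.
have [H1 _ _ H4 H5] := rq.
have ne e x : e \in edges q -> on e x -> x != 0.
  by move=> /C[c0 _]; apply: on_neq0.
have nev v : v \in q -> v != 0.
  by case/memP_vtx=> i hi ->; apply: (ne _ _ (mem_edge hi)); apply: seg_l.
pose E i := (vtx q i, vtx q i.+1).
pose crosses (z : nat * nat) (ab : 'I_n * 'I_n) := exists x y, [/\ on (E z.1) x, on (E z.2) y,
  sdir x = sdir y & [/\ dot (N ab.1) x = 0, dot (N ab.2) x = 0 & 0 < dot x (cross (N ab.1) (N ab.2))]].
have code z : exists ab, z \in s -> crosses z ab.
  have [zs|_] := boolP (z \in s); last by exists (Ordinal n1, Ordinal n1).
  case: z zs => i j zs; have [ij jq nij [x [y [ex ey Exy]]]] := Hs _ _ zs.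
  have ei := mem_edge (ltn_trans ij jq); have ej := mem_edge jq.
  have [ci [a [a1 a2]]] := C _ ei; have [cj [b [b1 b2]]] := C _ ej.
  have tr := crossing_transverse rq ei ej nij ci cj (N0 a) a1 a2 b1 b2 (N0 b) ex ey Exy.
  have ax := dot_on a1 a2 ex; have bx : dot (N b) x = 0.
    have [l l0 ->] := sdir_eq (ne _ _ ej ey) (ne _ _ ei ex) (esym Exy).
    by rewrite dotZr (dot_on b1 b2 ey) mulr0.
  have x0 := ne _ _ ei ex.
  (* Being orthogonal to both normals, [x] is parallel to their cross product, which is nonzero by
     transversality; one of the two orders makes the product positive. *)
  have : dot x (cross (N a) (N b)) != 0.
    apply: contra_neq tr => h.
    have h' : cross x (cross (N a) (N b)) = 0.
      by rewrite crossA [dot x _]dotC bx [dot x _]dotC ax !scale0r subr0.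
    by rewrite (cross_eq0 x0 h') h mul0r scale0r.
  rewrite neq_lt => /orP[h|h]; last by exists (a, b) => _; exists x, y.
  exists (b, a) => _; exists x, y; split=> //; split=> //=.
  by rewrite crossC dotNr oppr_gt0.
have [g Hg] := choice code.
(* Equal codes mean equal directions. As there are no triple points, both crossings then involve the
   same two edges, and these are listed in increasing order. *)
have g_inj : {in s &, injective g}.
  move=> z z' zs zs' Eg; have := Hg _ zs; have := Hg _ zs'; rewrite -Eg.
  move=> [x' [y' [ex' ey' Exy' [ax' bx' h']]]] [x [y [ex ey Exy [ax bx h]]]].
  have Ez := surjective_pairing z; have Ez' := surjective_pairing z'.
  rewrite Ez in zs; rewrite Ez' in zs'.
  have [ij jq _ _] := Hs _ _ zs; have [ij' jq' _ _] := Hs _ _ zs'.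
  have iq := ltn_trans ij jq; have iq' := ltn_trans ij' jq'.
  have Exx' : sdir x = sdir x'.
    by apply: perp2_sdir h (ltW h') => //; apply: (ne _ _ (mem_edge iq') ex').
  have trip (l : nat) y0 : (l < size q)%N -> on (E l) y0 -> sdir x = sdir y0 -> l = z.1 \/ l = z.2.
    move=> lq ez Exz; have [->|li] := eqVneq l z.1; first by left.
    have [->|lj] := eqVneq l z.2; first by right.
    have vneq (l1 l2 : nat) : (l1 < size q)%N -> (l2 < size q)%N -> l1 != l2 -> vtx q l1 != vtx q l2.
      by move=> h1 h2; apply: contra_neq => /(vtx_inj uq h1 h2).
    case: (H5 (E z.1) (E z.2) (E l) (mem_edge iq) (mem_edge jq) (mem_edge lq) _ _ _ x y y0) => //=.
    - by apply: vneq => //; rewrite ltn_eqF.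
    - by apply: vneq => //; rewrite eq_sym.
    - by apply: vneq => //; rewrite eq_sym.
  have T1 := trip z'.1 x' iq' ex' Exx'.
  have T2 : z'.2 = z.1 \/ z'.2 = z.2 by apply: (trip z'.2 y' jq' ey'); rewrite -Exy'.
  by rewrite Ez Ez'; congr pair; lia.
(* If the planes of arcs i and i+1 coincide any order would do, but for n = 2 this
   choice also gives the two junctions different pairs. *)
pose vcode i := if 0 <= dot (w i) (cross (N i) (N (ordS i))) then (i, ordS i) else (ordS i, i).
have ordS_neq (i : 'I_n) : ordS i != i.
  apply/eqP => /(congr1 val) /= h; have := ltn_ord i.
  have [h1|h1] := ltnP i.+1 n; first by move: h; rewrite modn_small //; lia.
  have En : i.+1 = n by have := ltn_ord i; lia.
  by move: h; rewrite En modnn; lia.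
have vc i : [/\ dot (N (vcode i).1) (w i) = 0, dot (N (vcode i).2) (w i) = 0,
   0 <= dot (w i) (cross (N (vcode i).1) (N (vcode i).2)) & (vcode i).1 != (vcode i).2].
  rewrite /vcode; have [h1 h2] := wN i; case: leP => h; split=> //=.
  - by rewrite eq_sym.
  - by rewrite crossC dotNr oppr_ge0 ltW.
(* Equal orders give [i = j] at once. Opposite orders require each arc to follow the other, and then
   both junctions lie on the same half-line and coincide. *)
have vcode_inj : injective vcode.
  move=> i j; have [wi1 wi2] := wN i; have [wj1 wj2] := wN j.
  rewrite /vcode; case: leP => hi; case: leP => hj [] // Ei Ej.
    rewrite -Ei in wj2 hj; rewrite Ej in wi2 hi.
    apply/wi/(H1 _ _ (wq i) (wq j))/esym.
    apply: (@perp2_sdir (N i) (N j)) => //; first exact: nev.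
    by rewrite crossC dotNr oppr_gt0.
  rewrite Ei in wi2 hi; rewrite -Ej in wj2 hj.
  apply/wi/(H1 _ _ (wq i) (wq j)).
  apply: (@perp2_sdir (N j) (N i)) => //; first exact: nev.
  by rewrite crossC dotNr oppr_gt0.
pose X := [set (i, i) | i : 'I_n] :|: [set vcode i | i : 'I_n].
have cX : #|X| = (n + n)%N.
  rewrite cardsU !card_imset ?card_ord //; last by move=> i j [].
  rewrite (_ : _ :&: _ = finset.set0) ?cards0 ?subn0 //; apply/setP => z; rewrite !inE.
  apply/negP => /andP[/imsetP[i _ ->] /imsetP[j _ Eij]].
  by have [_ _ _] := vc j; rewrite -Eij eqxx.
(* A diagonal code has cross product 0. A junction code would give the crossing the direction of a
   vertex, which regularity forbids. *)
have sub : {subset map g s <= ~: X}.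
  move=> _ /mapP[z zs ->]; have [x [y [ex ey Exy [ax bx h]]]] := Hg _ zs.
  rewrite !inE; apply/negP => /orP[/imsetP[i _ Ei]|/imsetP[i _ Ei]].
    by move: h; rewrite Ei /= crossvv dot0r ltxx.
  case: z zs ex ey Ei ax bx h => i' j' zs /= ex ey Ei ax bx h.
  have [ij jq nij _] := Hs _ _ zs.
  have [v1 v2 v3 _] := vc i; rewrite -Ei in v1 v2 v3.
  apply: (H4 _ _ (mem_edge (ltn_trans ij jq)) (mem_edge jq) nij x y ex ey Exy (w i) (wq i)).
  by apply: perp2_sdir h v3 => //; apply: nev.
have : (#|map g s| <= #|~: X|)%N by apply/subset_leq_card/fintype.subsetP.
have -> : #|map g s| = size s.
  by rewrite -(size_map g); apply/card_uniqP; rewrite map_inj_in_uniq.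
have := cardsC X; rewrite cX card_prod card_ord; lia.
Qed.

End Counting.

(** * Normals and junctions of the great circle arcs *)

Section Arcs.
Variable R : realType.
Implicit Types (p q : seq (pt R)) (e f g : pt R * pt R) (a b c x y v u : pt R).

Lemma vtx_addn p i : vtx p (i + size p) = vtx p i.
Proof. by rewrite /vtx modnDr. Qed.

Lemma vtx_modS p i : vtx p (i %% size p).+1 = vtx p i.+1.
Proof. by rewrite /vtx; congr nth; rewrite -addn1 modnDml addn1. Qed.

(** An arc is the stretch of edges between cyclically consecutive elements of [B]. The plane of its
    first edge is passed on from edge to edge by coplanarity at the vertices outside [B]. *)
Lemma arc_normals p (B : seq nat) : simple p ->
  (forall e, e \in edges p -> cross e.1 e.2 != 0) ->
  uniq B -> all (fun j => j < size p)%N B -> (1 < size B)%N ->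
  (forall j, (j < size p)%N -> j \notin B ->
     coplanar0 (vtx p (j + size p - 1)) (vtx p j) (vtx p j.+1)) ->
  exists N w : 'I_(size B) -> pt R,
    [/\ forall e, e \in edges p -> exists i, dot (N i) e.1 = 0 /\ dot (N i) e.2 = 0,
        forall i, N i != 0, forall i, w i \in p, injective w &
        forall i, dot (N i) (w i) = 0 /\ dot (N (ordS i)) (w i) = 0].
Proof.
move=> [p3 up _ _] C uB /allP Bp; set n := size B => n1 cop.
have p0 : (0 < size p)%N by apply: leq_trans p3.
have n0 : (0 < n)%N by apply: ltnW.
have crossS i : cross (vtx p i) (vtx p i.+1) != 0.
  rewrite -(vtx_mod p i) -vtx_modS; apply: (C (_, _)); apply: mem_edge; exact: ltn_pmod.
pose s := sort leq B.
have ss : sorted ltn s by rewrite ltn_sorted_uniq_leq sort_uniq uB sort_sorted //; apply: leq_total.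
have sn : size s = n by rewrite size_sort.
pose S i := nth 0%N s i.
have Sp i : (i < n)%N -> (S i < size p)%N.
  by move=> hi; apply: Bp; rewrite -(mem_sort leq) mem_nth // sn.
have Slt i j : (i < j)%N -> (j < n)%N -> (S i < S j)%N.
  by move=> ij jn; apply: (sorted_ltn_nth ltn_trans) => //; rewrite inE sn // (ltn_trans ij).
have Sle i j : (i <= j)%N -> (j < n)%N -> (S i <= S j)%N.
  by rewrite leq_eqVlt => /orP[/eqP->//|ij] jn; apply/ltnW/Slt.
have Sinv (x : nat) : x \in B -> exists2 i, (i < n)%N & S i = x.
  by rewrite -(mem_sort leq) => /(nthP 0%N)[i]; rewrite sn; exists i.
(* The index at which arc [i] ends. The last arc runs past the end of the list, which is harmless as
   [vtx] reduces indices modulo the size. *)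
pose nS i := if (i.+1 < n)%N then S i.+1 else (S 0%N + size p)%N.
have SnS i : (i < n)%N -> (S i < nS i)%N.
  by move=> hi; rewrite /nS; case: ifP => h; [apply: Slt|rewrite ltn_addl ?Sp].
pose N i := cross (vtx p (S i)) (vtx p (S i).+1).
have key i m : (i < n)%N -> (S i <= m < nS i)%N ->
    dot (N i) (vtx p m) = 0 /\ dot (N i) (vtx p m.+1) = 0.
  move=> hi; elim: m => [|m IH].
    by rewrite leqn0 => /andP[/eqP E _]; rewrite /N E dot_crossl dot_crossr.
  rewrite leq_eqVlt => /andP[/orP[/eqP E|lt1] lt2].
    by rewrite /N E dot_crossl dot_crossr.
  have [h1 h2] : dot (N i) (vtx p m) = 0 /\ dot (N i) (vtx p m.+1) = 0.
    by apply: IH; rewrite -ltnS lt1 ltnW.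
  split=> //.
  have nB : (m.+1 %% size p)%N \notin B.
    apply/negP => /Sinv[j hj Ej].
    have [hm|hm] := ltnP m.+1 (size p).
      rewrite modn_small // in Ej; move: lt2; rewrite /nS; case: ifP => hn lt2.
        have [ji|ij] := leqP j i; first by have := Sle _ _ ji hi; lia.
        by have := Sle _ _ ij hj; lia.
      by have := Sle j i _ hi; lia.
    move: lt2; rewrite /nS; case: ifP => hn lt2; first by have := Sp _ hn; lia.
    have : (S j < S 0)%N.
      rewrite Ej; have -> : m.+1 = (m.+1 - size p + size p)%N by lia.
      rewrite modnDr modn_small; [lia|have := Sp 0%N (ltn_trans (ltn0Sn 0) n1); lia].
    by rewrite ltnNge Sle.
  have := cop _ (ltn_pmod _ p0) nB; rewrite coplanar0E vtx_mod vtx_modS.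
  have -> : vtx p (m.+1 %% size p + size p - 1) = vtx p m.
    rewrite -addnBA // /vtx modnDml; congr nth.
    have -> : (m.+1 + (size p - 1) = m + size p)%N by lia.
    by rewrite modnDr.
  move=> /(plane_basis (crossS m))[al [be ->]].
  by rewrite dotDr !dotZr h1 h2 !mulr0 addr0.
exists (fun i => N i), (fun i : 'I_n => vtx p (S (ordS i))).
have ordSE (i : 'I_n) : vtx p (S (ordS i)) = vtx p (nS i).
  rewrite /nS /=; have [h|h] := ltnP i.+1 n; first by rewrite modn_small.
  have -> : i.+1 = n by apply/eqP; rewrite eqn_leq h andbT.
  by rewrite modnn vtx_addn.
split.
(* As [s] is sorted, [cnt] counts the break points up to [j], so edge [j] is on arc [cnt.-1]. If
   there are none, it is on the last arc, reached by adding [size p] to the index. *)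
- move=> _ /mem_edges[j hj ->] /=; pose cnt := find (fun x : nat => j < x)%N s.
  have cn : (cnt <= n)%N by rewrite -sn find_size.
  have [c0|c0] := posnP cnt.
    have jS : (j < S 0)%N.
      have hs : has (fun x : nat => j < x)%N s by rewrite has_find -/cnt c0 sn n0.
      by have := nth_find 0%N hs; rewrite -/cnt c0.
    have hn : (n.-1 < n)%N by rewrite ltn_predL n0.
    exists (Ordinal hn); rewrite /= -(vtx_addn p j) -(vtx_addn p j.+1) addSn.
    apply: key => //; rewrite /nS prednK ?n0 // ltnn ltn_add2r jS andbT.
    by have := Sp _ hn; lia.
  have hc : (cnt.-1 < n)%N by rewrite prednK.
  exists (Ordinal hc) => /=; apply: key => //; apply/andP; split.
    have : (cnt.-1 < find (fun x : nat => j < x) s)%N by rewrite -/cnt prednK.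
    by move=> /(before_find 0%N); rewrite -/(S _) => /negbT; rewrite -leqNgt.
  rewrite /nS prednK //; case: ifP => h; last by rewrite ltn_addl.
  have hs : has (fun x : nat => j < x)%N s by rewrite has_find -/cnt sn.
  exact: (nth_find 0%N hs).
- by move=> i; apply: crossS.
- by move=> i; apply: mem_vtx.
- move=> i j /(vtx_inj up (Sp _ (ltn_ord _)) (Sp _ (ltn_ord _))) E.
  apply: (can_inj (@ordSK n)); apply: val_inj; apply/eqP; case: ltngtP => // h.
    by have := Slt _ _ h (ltn_ord _); rewrite E ltnn.
  by have := Slt _ _ h (ltn_ord _); rewrite E ltnn.
- move=> i; split; last by rewrite dot_crossl.
  have h := SnS _ (ltn_ord i).
  have /(key _ _ (ltn_ord i))[_] : (S i <= (nS i).-1 < nS i)%N by lia.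
  by rewrite ordSE prednK //; lia.
Qed.

End Arcs.

(** * The bound on the crossing number *)

Section Main.
Variable R : realType.
Implicit Types (k p q : seq (pt R)).

(** A crossing is given by a mere proposition; its classical truth value filters the finite list of
    index pairs. *)
Lemma num_crossings_exists (h : pt R -> pt R) p : exists s : seq (nat * nat),
  uniq s /\ forall i j, (i, j) \in s <-> [/\ (i < j)%N, (j < size p)%N, ~ adjacent p i j
    & exists y, piece h p i y /\ piece h p j y].
Proof.
pose P (ij : nat * nat) := `[< [/\ (ij.1 < ij.2)%N, (ij.2 < size p)%N, ~ adjacent p ij.1 ij.2
    & exists y, piece h p ij.1 y /\ piece h p ij.2 y] >].
exists [seq ij <- [seq (i, j) | i <- iota 0 (size p), j <- iota 0 (size p)] | P ij]; split.
  by apply/filter_uniq/allpairs_uniq; rewrite ?iota_uniq // => -[a b] [c d] _ _ [-> ->].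
move=> i j; rewrite mem_filter; split=> [/andP[/asboolP //]|H].
apply/andP; split; first exact/asboolP.
have [ij jp _ _] := H; apply/allpairsP; exists (i, j).
by rewrite !mem_iota /= !add0n jp (ltn_trans ij jp).
Qed.

End Main.

Theorem theorem3p4 (R : realType) (k : seq (pt R)) (c n : nat) :
  nontrivial_knot k ->
  is_crossing_number k c ->
  spherical_stick_diagram k n ->
  1 + Num.sqrt (1 + c%:R) <= (n%:R : R).
Proof.
move=> [/simple_polygonP sk _] [_ cmin] [k' [kk' v0 vopp rp [B [uB Bk <- B2 cop]]]].
have sk' : simple k' by apply/(kequiv_simple kk').
have rk' := regular_projW sk' rp.
have [k3 uk' _ _] := sk'.
(* The ends of an edge are nonzero, with directions neither equal, by regularity, nor opposite, by
   hypothesis; hence they are independent and span the plane of a great circle. *)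
have C e : e \in edges k' -> cross e.1 e.2 != 0.
  move=> /mem_edges[i hi ->] /=; have a0 := v0 i hi.
  have b0 : vtx k' i.+1 != 0 by rewrite -vtx_mod v0 // ltn_pmod // (leq_trans _ hi).
  apply/eqP => /(cross_eq0 a0); set r := _ / _ => E.
  have r0 : r != 0 by apply: contra_neq b0 => r0; rewrite E r0 scale0r.
  have [H1 _ _ _ _] := rp; have := H1 i hi; have := vopp i hi.
  have [rn|rp0] := ltP r 0.
    rewrite -{1}(@sdir_opp _ (vtx k' i) (vtx k' i.+1)) ?eqxx //.
    by exists (- r); rewrite ?oppr_gt0 // opprK.
  by move=> _; rewrite E sdir_scale ?eqxx // lt0r r0.
have [N [w [NC N0 wk wi wN]]] := arc_normals sk' C uB Bk B2 cop.
have [t [gd gx]] := generic_direction rk' C.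
pose d := cross (u1 t) (u2 t).
(* The third coordinate of [d] is [1 + t ^+ 2]: the two curves of forms are chosen so that the
   half-space z > 0 serves for every [t]. *)
have d0 : 0 < cz d.
  by rewrite /d /cross /u1 /u2 !coE mulr1 mulrN opprK -expr2 ltr_wpDr ?sqr_ge0.
have i0 : subdivided k d (codom N) (codom w) [:: u1 t; u2 t] k'.
  split=> //.
  - move=> e ep; split; first exact: gd.
    by have [i Ni] := NC e ep; exists (N i) => //; apply: codom_f.
  - by move=> _ /codomP[i ->].
  - move=> e f ep fp nef x y ex fy Exy u; have [h1 h2] := gx e f ep fp nef x y ex fy Exy.
    by rewrite !inE => /orP[] /eqP ->.
have [q1 [iq1 b1 _]] := subdivided_good i0 (mem_head _ _).
have u2U : u2 t \in [:: u1 t; u2 t] by rewrite !inE eqxx orbT.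
have [q [iq b2 b1']] := subdivided_good iq1 u2U.
have [F [kF sF rF FE Fcov]] := spherical_to_planar iq (b1' _ b1) b2 d0.
have [[sq kq] rq Cq Wq _] := iq; have [q3 uq _ _] := sq.
have [s [us Hs]] := num_crossings_exists (@proj_xy R) (map F q).
have cs : (c <= size s)%N.
  apply: cmin; exists (map F q); split; first exact: kequiv_trans kq kF.
    exact: regular_projI.
  by exists s; split.
have bound : (size s + (size B + size B) <= size B * size B)%N.
  apply: (@crossing_bound R (size B) N w q s) => //.
  - move=> e ep; have [nd [_ /codomP[i ->] ?]] := Cq e ep; split; last by exists i.
    by apply: contra_neq nd => ->; rewrite dot0l.
  - by move=> i; apply: Wq; apply: codom_f.
  - move=> i j /Hs[ij]; rewrite size_map => jq na [y [pi pj]].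
    have iq' := ltn_trans ij jq.
    have [_ uF _ _] := sF.
    have vF l : (l < size q)%N -> vtx (map F q) l = F (vtx q l).
      by move=> hl; rewrite !vtx_small ?size_map // (nth_map 0).
    have vF1 l : (l < size q)%N -> vtx (map F q) l.+1 = F (vtx q l.+1).
      by move=> hl; rewrite -vtx_mod size_map vF ?vtx_mod // ltn_pmod // (leq_trans _ hl).
    have nij : nonadj (vtx q i, vtx q i.+1) (vtx q j, vtx q j.+1).
      apply/adjacentP => //; first by rewrite ltn_eqF.
      by move: na; rewrite /adjacent size_map.
    split=> //; case: pi pj => x1; rewrite /edge vF // vF1 // => /(Fcov (_, _) (mem_edge iq'))[x ex ->] ->.
    case=> y1; rewrite /edge vF // vF1 // => /(Fcov (_, _) (mem_edge jq))[z ez ->] E.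
    by exists x, z; split=> //; apply: (FE _ _ (mem_edge iq') (mem_edge jq)).
have n1 : (1 : R) <= (size B)%:R by rewrite ler1n ltnW.
have : (c%:R + (size B)%:R + (size B)%:R : R) <= (size B)%:R * (size B)%:R.
  by rewrite -!natrD -natrM ler_nat; lia.
set m := _%:R in n1 * => hm.
(* The count [c + 2n <= n^2] is the same as [1 + c <= (n - 1)^2], and [n - 1] is nonnegative. *)
rewrite addrC -lerBrDr -[X in _ <= X]ger0_norm ?subr_ge0 // -sqrtr_sqr ler_wsqrtr // expr2; lra.
Qed.
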